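(* Let $\xi$ be a positive integer-valued random variable with $1\le \xi\le \kappa$ almost surely for some constant $\kappa>1$, and assume $\mathbb{E}\,\xi>1$. For every $\varepsilon\in(0,1)$ there exists a constant $\gamma>0$ such that, whenever $r_n\ge \gamma\sqrt{\log n/n}$ for all $n$, $$\mathbb{P}\big(\mathscr C_1(\Gamma_n(r_n,\xi))\ge (1-\varepsilon)n\big)\longrightarrow 1 \quad (n\to\infty).$$
   Context: The unit square $[0,1]^2$ is viewed as a torus with distance $d(x,y)=\big(\sum_{i=1}^2\min(|x_i-y_i|,1-|x_i-y_i|)^2\big)^{1/2}$, and $B(x,r)=\{y: d(x,y)<r\}$. Let $\mathbf X=\{X_1,\dots,X_n\}$ be independent uniform points in $[0,1]^2$, and $r_n>0$. For $x\in[0,1]^2$ let $\rho(x)=|B(x,r_n)\cap\mathbf X|$. Each point $X_u$ is given an independent copy $\xi_u$ of $\xi$ (independent of $\mathbf X$); then, independently over $u$, a subset $\mathbf Y(X_u)$ of $\mathbf X\cap B(X_u,r_n)$ of size $\xi_u\wedge\rho(X_u)$ is chosen uniformly at random (without replacement). The digraph $\Gamma_n^+$ on vertex set $[n]=\{1,\dots,n\}$ has an oriented edge $(u,v)$, $u\neq v$, iff $X_v\in\mathbf Y(X_u)$ (a vertex selecting itself creates no edge). The random irrigation graph $\Gamma_n=\Gamma_n(r_n,\xi)$ is the undirected graph on $[n]$ in which $\{u,v\}$ is an edge iff $(u,v)$ or $(v,u)$ is an edge of $\Gamma_n^+$. For a graph $G$, $\mathscr C_1(G)$ denotes the number of vertices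 of its largest connected component. *)

(* Defs.v *)
From HB Require Import structures.
From mathcomp Require Import all_boot all_order all_algebra.
From mathcomp Require Import all_classical all_reals all_analysis.
Set Implicit Arguments. Unset Strict Implicit. Unset Printing Implicit Defensive.
Import Order.TTheory GRing.Theory Num.Theory.
Local Open Scope classical_set_scope.
Local Open Scope ring_scope.

Section Irrigation.
Variable R : realType.

Definition tcoord (t : R) : R := Num.min `|t| (1 - `|t|).

Definition tdist (p q : R * R) : R :=
  Num.sqrt (tcoord (p.1 - q.1) ^+ 2 + tcoord (p.2 - q.2) ^+ 2).

Variables (n : nat) (x : 'I_n -> R * R) (r : R).

(* indices of the points of X in B(x_u, r) (x_u itself included) *)
Definition nbhd (u : 'I_n) : {set 'I_n} := [set v | tdist (x u) (x v) < r].

Definition rho (u : 'I_n) : nat := #|nbhd u|.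

Definition irr_edge (Y : {ffun 'I_n -> {set 'I_n}}) : rel 'I_n :=
  fun u v => (u != v) && ((v \in Y u) || (u \in Y v)).

Definition C1 (e : rel 'I_n) : nat := \max_(u : 'I_n) #|[set v | connect e u v]|.

(* Probability (given xi = k) that the selections are Y:
   each Y u is a uniform subset of nbhd u of size min(k u, rho u). *)
Definition sel_weight (k : {ffun 'I_n -> nat}) (Y : {ffun 'I_n -> {set 'I_n}}) : R :=
  \prod_(u : 'I_n)
     (if (Y u \subset nbhd u) && (#|Y u| == minn (k u) (rho u))
      then ('C(rho u, minn (k u) (rho u)))%:R^-1 else 0).

(* Conditional probability, given the points x, that
   C1(Gamma_n) >= (1 - eps) n, when xi has pmf p supported on {0,...,K}. *)
Definition cond_prob (K : nat) (p : nat -> R) (eps : R) : R :=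
  \sum_(k : {ffun 'I_n -> 'I_K.+1})
    (\prod_(u : 'I_n) p (k u)) *
    \sum_(Y : {ffun 'I_n -> {set 'I_n}})
       sel_weight [ffun u => nat_of_ord (k u)] Y *
       (if (1 - eps) * n%:R <= (C1 (irr_edge Y))%:R then 1 else 0).

End Irrigation.

Fixpoint iter_int (R : realType) (m : nat) (f : seq (R * R) -> R) : R :=
  match m with
  | 0 => f [::]
  | m'.+1 =>
      Rintegral (@lebesgue_measure R) `[0%R, 1%R]
        (fun a => Rintegral (@lebesgue_measure R) `[0%R, 1%R]
          (fun b => iter_int m' (fun s => f ((a, b) :: s))))
  end.

(* P( C1(Gamma_n(r, xi)) >= (1 - eps) n ), X_1..X_n i.i.d. uniform on [0,1]^2,
   xi with pmf p supported in {0..K}. *)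
Definition prob_giant (R : realType) (K : nat) (p : nat -> R) (n : nat) (r eps : R) : R :=
  iter_int n (fun s : seq (R * R) =>
    cond_prob (fun i : 'I_n => nth (0, 0) s i) r K p eps).

(* Main.v *)
Require Import Defs.
From HB Require Import structures.
From mathcomp Require Import all_boot all_order all_algebra.
From mathcomp Require Import all_classical all_reals all_analysis.
From mathcomp Require Import measurable_realfun.
From mathcomp Require Import ring lra zify.
Set Implicit Arguments. Unset Strict Implicit. Unset Printing Implicit Defensive.
Import Order.TTheory GRing.Theory Num.Theory.
Import numFieldNormedType.Exports.

(** Put q = 1 - p 1 > 0. If the largest component is too small, some set A of
vertices with eps n / 3 <= |A| <= (1 - eps / 3) n is crossed by no edge. Let
g_u be the fraction of the points of the ball of u on the other side of A than
u. A vertex u with its own picks respects the cut with probability at most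
(1 - g_u) (1 - q g_u) <= (1 - g_u) exp (- q g_u).

Without the factor exp (- q g_u) the expected number of respected cuts is
essentially at most one per density profile of A on a fine grid: once the
profile is fixed, the two numbers 1 - g_u that u would have on either side of A
are bounded by quantities not depending on A whose sum is at most 1 + eta.
Hence the factor exp (- q sum_u g_u) is gained over the whole count.

The count must be localized, because small components make the number of
global cuts exponential. A coarse cell (side of order r) is called discordant
when the sum of g_u over it is at least a constant times the number mu of
points of a cell; as A is macroscopic and the grid connected, one such cell q
exists. Let G_k be the sum of g_u over the block of cells within 5 k steps of
q. The vertices of the k-th shell are summed over without any constraint, which
costs about L times their minority count, up to an error exp (- L) per vertex;
the minority count is bounded by a constant times G_(k+1) - G_k. If this cost
exceeded q G_k / 2 for all k < L ^ 2 then G_k would grow like (1 + c / L) ^ k,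
whereas it is at most quadratic in k. So for some bounded k the gain wins by
exp (- c mu), and mu >= g ln n with g large beats the union over the cells and
the profiles, polynomially many in n.

The points only enter through the numbers of points in the cells, which
concentrate by Chernoff's bound, so the integrals are only needed for functions
constant on cells. *)

Local Open Scope classical_set_scope.
Local Open Scope ring_scope.

(** * Reduction of the integrals to finite averages *)

(* No measurability is needed, the integral of a nonnegative function being a
   supremum over the simple functions below it; this spares proving that
   [cond_prob] is measurable in the points. *)
Lemma ge0_le_integral_nonmeas d (T : measurableType d) (R : realType)
    (mu : {measure set T -> \bar R}) (D : set T) (f g : T -> \bar R) :
  (forall x, D x -> (0 <= f x)%E) -> (forall x, D x -> (f x <= g x)%E) ->
  (\int[mu]_(x in D) f x <= \int[mu]_(x in D) g x)%E.
Proof.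
move=> f0 fg; have g0 x : D x -> (0 <= g x)%E.
  by move=> Dx; apply: le_trans (fg _ Dx); exact: f0.
rewrite !ge0_integralE//; apply: le_ereal_sup => _ [h hf <-].
by exists h => // x; apply: le_trans (hf x) _; exact: lee_restrict.
Qed.

(** [Rintegral] is the [fine] part of an extended integral, and [fine] is monotone only between
    finite values; the bound [g <= 1] provides the finiteness. *)
Lemma Rintegral01_mono (R : realType) (f g : R -> R) :
  (forall x : R, 0 <= x <= 1 -> 0 <= f x) ->
  (forall x : R, 0 <= x <= 1 -> f x <= g x) ->
  (forall x : R, 0 <= x <= 1 -> g x <= 1) ->
  [/\ 0 <= Rintegral (@lebesgue_measure R) `[0%R, 1%R] f,
   Rintegral (@lebesgue_measure R) `[0%R, 1%R] f <=
     Rintegral (@lebesgue_measure R) `[0%R, 1%R] g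
   & Rintegral (@lebesgue_measure R) `[0%R, 1%R] g <= 1].
Proof.
move=> f0 fg g1.
have memE (x : R) : x \in `[0%R, 1%R] -> 0 <= x <= 1 by rewrite in_itv.
pose I (h : R -> R) := (\int[@lebesgue_measure R]_(x in `[0%R, 1%R]) (h x)%:E)%E.
have If0 : (0 <= I f)%E.
  by apply: integral_ge0 => x /memE x01; rewrite lee_fin f0.
have Ifg : (I f <= I g)%E.
  by apply: ge0_le_integral_nonmeas => x /memE x01; rewrite lee_fin ?f0 ?fg.
have Ig1 : (I g <= 1)%E.
  have -> : (1 = \int[@lebesgue_measure R]_(x in `[0%R, 1%R]) 1%:E)%E.
    by rewrite integral_cst//= lebesgue_measure_itv/= lte01 mul1e sube0.
  apply: ge0_le_integral_nonmeas => x /memE x01; rewrite lee_fin ?g1//.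
  by apply: le_trans (fg _ x01); exact: f0.
have fing : (I g \is a fin_num)%E.
  rewrite ge0_fin_numE; first exact: le_lt_trans Ig1 (ltry _).
  exact: le_trans If0 Ifg.
have finf : (I f \is a fin_num)%E.
  by rewrite ge0_fin_numE//; apply: le_lt_trans Ifg _; rewrite ltey_eq fing.
split; rewrite /Rintegral.
- exact: fine_ge0.
- exact: fine_le.
- by rewrite -[leRHS]/(fine 1%:E); apply: fine_le.
Qed.

Definition in_square (R : realType) (z : R * R) :=
  (0 <= z.1 <= 1) && (0 <= z.2 <= 1).

(** The three conclusions are proved together because each further integration needs all three for
    the inner integrals. *)
Lemma iter_int_mono (R : realType) (n : nat) (f g : seq (R * R) -> R) :
  (forall s, size s = n -> all (@in_square R) s -> 0 <= f s) ->
  (forall s, size s = n -> all (@in_square R) s -> f s <= g s) ->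
  (forall s, size s = n -> all (@in_square R) s -> g s <= 1) ->
  [/\ 0 <= iter_int n f, iter_int n f <= iter_int n g & iter_int n g <= 1].
Proof.
elim: n f g => [|n IHn] f g f0 fg g1 /=; first by split; [exact: f0|exact: fg|exact: g1].
have step (a b : R) : 0 <= a <= 1 -> 0 <= b <= 1 ->
    [/\ 0 <= iter_int n (fun s => f ((a, b) :: s)),
     iter_int n (fun s => f ((a, b) :: s)) <= iter_int n (fun s => g ((a, b) :: s))
     & iter_int n (fun s => g ((a, b) :: s)) <= 1].
  move=> ha hb; apply: IHn => s sn sa.
  - by apply: f0 => /=; rewrite ?sn// /in_square/= ha hb.
  - by apply: fg => /=; rewrite ?sn// /in_square/= ha hb.
  - by apply: g1 => /=; rewrite ?sn// /in_square/= ha hb.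
have step2 a (ha : 0 <= a <= 1) := @Rintegral01_mono R
  (fun b => iter_int n (fun s => f ((a, b) :: s)))
  (fun b => iter_int n (fun s => g ((a, b) :: s)))
  (fun b hb => let: And3 h _ _ := step a b ha hb in h)
  (fun b hb => let: And3 _ h _ := step a b ha hb in h)
  (fun b hb => let: And3 _ _ h := step a b ha hb in h).
by apply: Rintegral01_mono => a ha; case: (step2 a ha).
Qed.

(* The endpoint 1 is put into the last cell. *)
Definition cell_index (R : realType) (m : nat) (a : R) : 'I_m.+1 :=
  inord (minn m (Num.trunc (m.+1%:R * a))).

Lemma cell_index_bounds (R : realType) (m : nat) (a : R) : 0 <= a <= 1 ->
  (cell_index m a)%:R <= m.+1%:R * a <= (cell_index m a)%:R + 1.
Proof.
move=> /andP[a0 a1]; rewrite /cell_index inordK; last by rewrite ltnS geq_minl.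
have ma0 : 0 <= m.+1%:R * a by rewrite mulr_ge0.
have /andP[tl tu] := truncn_itv ma0.
case: (leqP m (Num.trunc (m.+1%:R * a))) => h.
  rewrite -natr1; apply/andP; split; last by rewrite -[leRHS]mulr1 ler_wpM2l// natr1.
  by rewrite natr1; apply: le_trans tl; rewrite ler_nat.
by rewrite tl /= natr1 ltW.
Qed.

Lemma cell_indexE (R : realType) (m k : nat) (a : R) : (k < m.+1)%N ->
  k%:R / m.+1%:R <= a < k.+1%:R / m.+1%:R -> cell_index m a = inord k.
Proof.
move=> km; rewrite ler_pdivrMr// ltr_pdivlMr// => /andP[h1 h2].
rewrite /cell_index; congr inord.
have -> : Num.trunc (m.+1%:R * a) = k.
  by apply: truncn_def; rewrite mulrC h1.
by apply/minn_idPr; rewrite -ltnS.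
Qed.

(** Cells are added one by one from the left; measurability is carried through the induction because
    additivity of the integral over adjacent intervals requires it. *)
Lemma Rintegral01_cell (R : realType) (m : nat) (phi : 'I_m.+1 -> R) :
  (forall i, 0 <= phi i) ->
  Rintegral (@lebesgue_measure R) `[0%R, 1%R] (fun a => phi (cell_index m a)) =
  m.+1%:R^-1 * \sum_i phi i.
Proof.
move=> phi0; set M : R := m.+1%:R; have M0 : 0 < M by rewrite ltr0n.
pose g (a : R) : R := phi (cell_index m a).
pose f (a : R) := (g a)%:E.
suff main k : (k <= m.+1)%N ->
    measurable_fun `[0%R, (k%:R / M)%R[ g /\
    (\int[@lebesgue_measure R]_(x in `[0%R, (k%:R / M)%R[) f x =
     (M^-1 * \sum_(i < m.+1 | (i < k)%N) phi i)%:E)%E.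
  have [] := main m.+1 (leqnn _); rewrite divff ?gt_eqF// => mf intf.
  (* The point 1 is a null set; without it the last cell is half open like the others. *)
  rewrite /Rintegral -integral_itv_bndo_bndc; last exact/measurable_EFinP.
  rewrite intf/=.
  by congr (_ * _); apply: eq_bigl => i; rewrite ltn_ord.
elim: k => [|k IHk] km.
  rewrite mul0r set_itv_ge ?bnd_simp//; split; first exact: measurable_fun_set0.
  by rewrite integral_set0 big_pred0 ?mulr0.
have [mf intf] := IHk (ltnW km).
have setE : [set` `[0, (k.+1%:R / M)[] =
    `[0, (k%:R / M)[%classic `|` `[(k%:R / M), (k.+1%:R / M)[%classic :> set R.
  by apply: itv_bndbnd_setU; rewrite bnd_simp ?divr_ge0// ler_pM2r ?invr_gt0// ler_nat.
have fE : {in `[(k%:R / M), (k.+1%:R / M)[%classic, cst (phi (inord k)) =1 g}.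
  move=> x; rewrite inE/= in_itv/= => hx; rewrite /g (@cell_indexE _ _ k)//.
have mf2 : measurable_fun `[(k%:R / M), (k.+1%:R / M)[ g.
  by apply: eq_measurable_fun fE _; exact: measurable_cst.
have mfU : measurable_fun `[0%R, (k.+1%:R / M)%R[ g.
  by rewrite setE; apply/measurable_funU.
have disj : [disjoint `[0, (k%:R / M)[%classic & `[(k%:R / M), (k.+1%:R / M)[%classic].
  rewrite disj_set2E; apply/eqP; rewrite -subset0 => x /= [].
  rewrite !in_itv/= => /andP[_ h1] /andP[h2 _].
  by move: (lt_le_trans h1 h2); rewrite ltxx.
have mfU' : measurable_fun (`[0, (k%:R / M)[ `|` `[(k%:R / M), (k.+1%:R / M)[) f.
  by rewrite -setE; exact/measurable_EFinP.
split=> //; rewrite setE.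
have f0 x : (`[0, (k%:R / M)[%classic `|` `[(k%:R / M), (k.+1%:R / M)[%classic) x -> (0 <= f x)%E.
  by move=> _; rewrite lee_fin; exact: phi0.
rewrite ge0_integral_setU; [|exact: measurable_itv|exact: measurable_itv|exact: mfU'|exact: f0|exact: disj].
have int2 : (\int[@lebesgue_measure R]_(x in `[(k%:R / M)%R, (k.+1%:R / M)%R[) f x =
    (phi (inord k) / M)%:E)%E.
  transitivity (\int[@lebesgue_measure R]_(x in `[(k%:R / M)%R, (k.+1%:R / M)%R[)
      (phi (inord k))%:E)%E.
    by apply: eq_integral => x /fE; rewrite /f => <-.
  rewrite integral_cst//= lebesgue_measure_itv/=.
  rewrite lte_fin ltr_pM2r ?invr_gt0// ltr_nat leqnn -EFinB -EFinM; congr (_%:E).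
  by rewrite -mulrBl -natrB// subSnn mul1r.
rewrite intf int2 -EFinD; congr (_%:E).
rewrite [in RHS](bigD1 (inord k)) /= ?inordK//.
rewrite mulrDr addrC mulrC; congr (_ + _ * _); apply: eq_bigl => i.
rewrite ltnS andbC [in RHS]leq_eqVlt -(inj_eq val_inj) /= inordK//.
by case: (ltngtP i k).
Qed.

(** Expectation over [n] independent uniform elements of [C], in a recursive form that mirrors
    [iter_int]. *)
Fixpoint iter_avg (R : realType) (C : finType) (n : nat) (H : seq C -> R) : R :=
  if n is n'.+1 then #|C|%:R^-1 * \sum_c iter_avg n' (fun s => H (c :: s)) else H [::].

Definition cell_of (R : realType) (m : nat) (z : R * R) : 'I_m.+1 * 'I_m.+1 :=
  (cell_index m z.1, cell_index m z.2).

Lemma iter_avg_ge0 (R : realType) (C : finType) (n : nat) (H : seq C -> R) :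
  (forall s, 0 <= H s) -> 0 <= iter_avg n H.
Proof.
elim: n H => [|n IHn] H H0 //=.
by rewrite mulr_ge0 ?invr_ge0// sumr_ge0// => c _; apply: IHn.
Qed.

Lemma iter_int_cells (R : realType) (m n : nat)
    (H : seq ('I_m.+1 * 'I_m.+1) -> R) : (forall s, 0 <= H s) ->
  iter_int n (fun s => H (map (@cell_of R m) s)) = iter_avg n H.
Proof.
elim: n H => [//|n IHn] H H0 /=.
pose Phi i j := iter_avg n (fun s => H ((i, j) :: s)).
have Phi0 i j : 0 <= Phi i j by apply: iter_avg_ge0 => s.
have E1 (a b : R) : iter_int n (fun s => H (cell_of m (a, b) :: map (@cell_of R m) s)) =
    Phi (cell_index m a) (cell_index m b).
  by rewrite (IHn (fun s => H (cell_of m (a, b) :: s))).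
under [X in Rintegral _ _ X]funext => a.
  under [X in Rintegral _ _ X]funext => b do rewrite E1.
  rewrite (Rintegral01_cell (Phi0 (cell_index m a))).
  over.
rewrite (Rintegral01_cell (phi := fun i => m.+1%:R^-1 * \sum_j Phi i j)); last first.
  by move=> i; rewrite mulr_ge0 ?invr_ge0// sumr_ge0.
rewrite -mulr_sumr mulrA pair_big/= card_prod card_ord natrM invfM; congr (_ * _).
by apply: eq_bigr => -[].
Qed.

Local Close Scope classical_set_scope.

Lemma iter_avg_le (R : realType) (C : finType) (n : nat) (G H : seq C -> R) :
  (forall s, size s = n -> G s <= H s) -> iter_avg n G <= iter_avg n H.
Proof.
elim: n G H => [|n IHn] G H GH /=; first exact: GH.
rewrite ler_wpM2l ?invr_ge0// ler_sum// => c _; apply: IHn => s sn.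
by apply: GH; rewrite /= sn.
Qed.

Lemma iter_avgD (R : realType) (C : finType) (n : nat) (G H : seq C -> R) :
  iter_avg n (fun s => G s + H s) = iter_avg n G + iter_avg n H.
Proof.
elim: n G H => [//|n IHn] G H /=.
under eq_bigr => c _ do rewrite IHn.
by rewrite big_split mulrDr.
Qed.

Lemma iter_avgZ (R : realType) (C : finType) (n : nat) (a : R) (H : seq C -> R) :
  iter_avg n (fun s => a * H s) = a * iter_avg n H.
Proof.
elim: n H => [//|n IHn] H /=.
under eq_bigr => c _ do rewrite IHn.
by rewrite -mulr_sumr mulrCA.
Qed.

Lemma iter_avg_sum (R : realType) (C I : finType) (n : nat) (H : I -> seq C -> R) :
  iter_avg n (fun s => \sum_i H i s) = \sum_i iter_avg n (H i).
Proof.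
elim: n H => [//|n IHn] H /=.
under eq_bigr => c _ do rewrite IHn.
by rewrite exchange_big/= mulr_sumr.
Qed.

Lemma iter_avg_prod (R : realType) (C : finType) (n : nat) (f : C -> R) :
  iter_avg n (fun s => \prod_(c <- s) f c) = (#|C|%:R^-1 * \sum_c f c) ^+ n.
Proof.
elim: n => [|n IHn] /=; first by rewrite big_nil.
rewrite exprS -IHn -mulrA; congr (_ * _); rewrite mulr_suml.
by apply: eq_bigr => c _; under eq_fun do rewrite big_cons; rewrite iter_avgZ.
Qed.

Lemma iter_avg_cst (R : realType) (C : finType) (n : nat) (a : R) :
  (0 < #|C|)%N -> iter_avg n (fun _ : seq C => a) = a.
Proof.
move=> C0; elim: n => [//|n IHn] /=.
rewrite IHn sumr_const -[a *+ _]mulr_natr mulrCA mulVf ?mulr1// pnatr_eq0.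
by rewrite -lt0n.
Qed.

(** * Chernoff bounds for the cell counts *)

Lemma prod_count (R : realType) (C : finType) (c : C) (t : R) (s : seq C) :
  \prod_(d <- s) expR (t * (d == c)%:R) = expR (t * (count_mem c s)%:R).
Proof.
elim: s => [|d s IHs]; first by rewrite big_nil mulr0 expR0.
by rewrite big_cons IHs -expRD -mulrDr -natrD.
Qed.

(** The binomial moment generating function: by independence the average is the [n]-th power of 1 +
    (exp t - 1) / |C|, and 1 + y <= exp y. *)
Lemma iter_avg_exp_count (R : realType) (C : finType) (c : C) (n : nat) (t : R) :
  iter_avg n (fun s : seq C => expR (t * (count_mem c s)%:R)) <=
  expR (n%:R / #|C|%:R * (expR t - 1)).
Proof.
have C0 : #|C|%:R != 0 :> R by rewrite pnatr_eq0 -lt0n; apply/card_gt0P; exists c.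
have := iter_avg_prod n (fun d => expR (t * (d == c)%:R)).
under eq_fun do rewrite prod_count.
move=> ->; rewrite -mulrA expRM_natl; apply: lerXn2r; rewrite ?nnegrE ?expR_ge0//.
  by rewrite mulr_ge0 ?invr_ge0// sumr_ge0// => d _; exact: expR_ge0.
apply: le_trans (expR_ge1Dx _).
rewrite (bigD1 c)//= eqxx mulr1.
rewrite (eq_bigr (fun=> 1)); last by move=> d /negPf ->; rewrite mulr0 expR0.
rewrite sumr_const (_ : #|(fun i => i != c)| = #|C|.-1) ?(cardC1 c)//.
have -> : #|C|.-1%:R = #|C|%:R - 1 :> R.
  by rewrite -subn1 natrB//; apply/card_gt0P; exists c.
have -> : #|C|%:R^-1 * (expR t + (#|C|%:R - 1)) = 1 + #|C|%:R^-1 * (expR t - 1) by field.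
by [].
Qed.

Lemma expR_le_inv (R : realType) (x : R) : x < 1 -> expR x <= (1 - x)^-1.
Proof.
move=> x1; rewrite -[x]opprK expRN opprK lef_pV2 ?posrE ?expR_gt0 ?subr_gt0//.
by have := expR_ge1Dx (- x).
Qed.

Lemma markov_exp (R : realType) (b : bool) (y : R) : (b -> 0 <= y) ->
  b%:R <= expR y.
Proof.
case: b => [/(_ isT) y0|_]; last exact: expR_ge0.
by rewrite -expR0 ler_expR.
Qed.

Lemma iter_avg_count_gt (R : realType) (C : finType) (c : C) (n : nat) :
  iter_avg n (fun s : seq C =>
    (2 * (n%:R / #|C|%:R) < (count_mem c s)%:R :> R)%R%:R) <=
  expR (- (n%:R / #|C|%:R / 20)) :> R.
Proof.
set mu := n%:R / _.
have mu0 : 0 <= mu by rewrite divr_ge0.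
(* Chernoff with t = 1/4: since exp (1/4) <= 4/3, the exponent is at most (- 1/2 + 1/3) mu, below -
   mu / 20. *)
apply: (@le_trans _ _ (iter_avg n (fun s : seq C =>
    expR (- (mu / 2)) * expR (4^-1 * (count_mem c s)%:R)))).
  apply: iter_avg_le => s _; rewrite -expRD; apply: markov_exp.
  by move: (_%:R : R) => z h; lra.
rewrite iter_avgZ.
apply: (@le_trans _ _ (expR (- (mu / 2)) * expR (mu * (expR 4^-1 - 1)))).
  by rewrite ler_wpM2l ?expR_ge0//; exact: iter_avg_exp_count.
rewrite -expRD ler_expR.
have := @expR_le_inv R 4^-1 ltac:(lra).
have -> : (1 - 4^-1)^-1 = 4 / 3 :> R by field.
move=> h; have : mu * (expR 4^-1 - 1) <= mu * (1/3) by apply: ler_wpM2l => //; lra.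
lra.
Qed.

Lemma iter_avg_count_lt (R : realType) (C : finType) (c : C) (n : nat) :
  iter_avg n (fun s : seq C =>
    ((count_mem c s)%:R < n%:R / #|C|%:R / 2 :> R)%R%:R) <=
  expR (- (n%:R / #|C|%:R / 20)) :> R.
Proof.
set mu := n%:R / _.
have mu0 : 0 <= mu by rewrite divr_ge0.
(* Chernoff with t = - 1/4: since exp (- 1/4) <= 4/5, the exponent is at most (1/8 - 1/5) mu, below
   - mu / 20. *)
apply: (@le_trans _ _ (iter_avg n (fun s : seq C =>
    expR (mu / 8) * expR (- 4^-1 * (count_mem c s)%:R)))).
  apply: iter_avg_le => s _; rewrite -expRD; apply: markov_exp.
  by move: (_%:R : R) => z h; lra.
rewrite iter_avgZ.
apply: (@le_trans _ _ (expR (mu / 8) * expR (mu * (expR (- 4^-1) - 1)))).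
  by rewrite ler_wpM2l ?expR_ge0//; exact: iter_avg_exp_count.
rewrite -expRD ler_expR.
have := @expR_le_inv R (- 4^-1) ltac:(lra).
have -> : (1 - - 4^-1)^-1 = 4 / 5 :> R by field.
move=> h; have : mu * (expR (- 4^-1) - 1) <= mu * (- 5^-1) by apply: ler_wpM2l => //; lra.
lra.
Qed.

Definition balanced (R : realType) (C : finType) (n : nat) (s : seq C) : bool :=
  [forall c : C, (n%:R / #|C|%:R / 2 <= (count_mem c s)%:R :> R) &&
                 ((count_mem c s)%:R <= 2 * (n%:R / #|C|%:R) :> R)].

Lemma iter_avg_balanced (R : realType) (C : finType) (n : nat) : (0 < #|C|)%N ->
  1 - 2 * #|C|%:R * expR (- (n%:R / #|C|%:R / 20)) <=
  iter_avg n (fun s : seq C => (balanced R n s)%:R : R).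
Proof.
move=> C0; rewrite lerBlDr.
pose gt c (s : seq C) : R := (2 * (n%:R / #|C|%:R) < (count_mem c s)%:R :> R)%R%:R.
pose lt c (s : seq C) : R := ((count_mem c s)%:R < n%:R / #|C|%:R / 2 :> R)%R%:R.
apply: (@le_trans _ _ (iter_avg n (fun s : seq C => (balanced R n s)%:R +
    \sum_c (gt c s + lt c s)))).
  rewrite -[leLHS](@iter_avg_cst _ C n)//; apply: iter_avg_le => s _.
  have pos c : 0 <= gt c s + lt c s by rewrite addr_ge0.
  case: (boolP (balanced R n s)) => [_|]; first by rewrite lerDl sumr_ge0.
  rewrite negb_forall => /existsP[c hc]; rewrite add0r (bigD1 c)//=.
  have -> : 1 <= gt c s + lt c s + \sum_(i | i != c) (gt i s + lt i s) => //.
  apply: (@le_trans _ _ (gt c s + lt c s)); last by rewrite lerDl sumr_ge0.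
  move: hc; rewrite negb_and -!ltNge => /orP[h|h].
    by rewrite /lt h lerDr.
  by rewrite /gt h lerDl.
rewrite iter_avgD lerD2l iter_avg_sum.
have -> : 2 * #|C|%:R * expR (- (n%:R / #|C|%:R / 20)) =
    \sum_(c : C) (2 * expR (- (n%:R / #|C|%:R / 20))) :> R.
  by rewrite sumr_const -[RHS]mulr_natl -mulrA mulrCA.
apply: ler_sum => c _; rewrite iter_avgD [2 * _]mulr_natl mulr2n.
exact: lerD (iter_avg_count_gt _ _ _) (iter_avg_count_lt _ _ _).
Qed.

(** * Selections *)

(* Law of the out-neighbourhood of [u], averaged over [xi_u]. *)
Definition pick_weight (R : realType) (n : nat) (x : 'I_n -> R * R) (r : R)
    (K : nat) (p : nat -> R) (u : 'I_n) (S : {set 'I_n}) : R :=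
  \sum_(j < K.+1) p j *
    (if (S \subset nbhd x r u) && (#|S| == minn j (rho x r u))
     then ('C(rho x r u, minn j (rho x r u)))%:R^-1 else 0).

(** Marks and selections both factor over the vertices, so by distributivity the marks can be
    averaged out vertex by vertex. *)
Lemma cond_probE (R : realType) (n : nat) (x : 'I_n -> R * R) (r : R)
    (K : nat) (p : nat -> R) (eps : R) :
  cond_prob x r K p eps =
  \sum_(Y : {ffun 'I_n -> {set 'I_n}}) (\prod_u pick_weight x r K p u (Y u)) *
    ((1 - eps) * n%:R <= (C1 (irr_edge Y))%:R)%R%:R.
Proof.
rewrite /cond_prob; under eq_bigr => k _ do rewrite mulr_sumr.
rewrite exchange_big/=; apply: eq_bigr => Y _.
under eq_bigr => k _ do rewrite mulrA.
rewrite -mulr_suml; congr (_ * _); last by case: ifP.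
rewrite /pick_weight bigA_distr_bigA/=; apply: eq_bigr => k _.
by rewrite /sel_weight -big_split/=; apply: eq_bigr => u _; rewrite !ffunE.
Qed.

Lemma pick_weight_ge0 (R : realType) (n : nat) (x : 'I_n -> R * R) (r : R)
    (K : nat) (p : nat -> R) (u : 'I_n) (S : {set 'I_n}) :
  (forall k, 0 <= p k) -> 0 <= pick_weight x r K p u S.
Proof.
move=> p0; apply: sumr_ge0 => j _; apply: mulr_ge0 => //.
by case: ifP => _ //; rewrite invr_ge0.
Qed.

Lemma sum_pick_weight_sub (R : realType) (n : nat) (x : 'I_n -> R * R) (r : R)
    (K : nat) (p : nat -> R) (u : 'I_n) (B : {set 'I_n}) :
  \sum_(S : {set 'I_n} | S \subset B) pick_weight x r K p u S =
  \sum_(j < K.+1) p j * (('C(#|B :&: nbhd x r u|, minn j (rho x r u)))%:R /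
    ('C(rho x r u, minn j (rho x r u)))%:R).
Proof.
rewrite /pick_weight exchange_big/=; apply: eq_bigr => j _.
rewrite -mulr_sumr; congr (_ * _).
rewrite -big_mkcondr/= sumr_const -[LHS]mulr_natl; congr (_%:R * _).
rewrite -cards_draws; apply: eq_card => S; rewrite !inE finset.subsetI.
by rewrite unfold_in andbA.
Qed.

Lemma sum_pick_weight (R : realType) (n : nat) (x : 'I_n -> R * R) (r : R)
    (K : nat) (p : nat -> R) (u : 'I_n) :
  \sum_(j < K.+1) p j = 1 -> \sum_(S : {set 'I_n}) pick_weight x r K p u S = 1.
Proof.
move=> p1; rewrite -[RHS]p1 (eq_bigl (fun S : {set 'I_n} => S \subset [set: 'I_n])); last first.
  by move=> S; rewrite finset.subsetT.
rewrite sum_pick_weight_sub; apply: eq_bigr => j _.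
rewrite finset.setTI -/(rho x r u) divff ?mulr1// pnatr_eq0 -lt0n bin_gt0.
exact: geq_minr.
Qed.

(** The quotient is the product of the (a - i) / (b - i) for i < j, each at most a / b. *)
Lemma bin_ratio_le (R : realType) (a b j : nat) : (a <= b)%N -> (j <= b)%N ->
  ('C(a, j))%:R / ('C(b, j))%:R <= (a%:R / b%:R) ^+ j :> R.
Proof.
elim: j a b => [|j IHj] a b ab jb; first by rewrite !bin0 expr0 divr1.
case: a ab => [|a] ab; first by rewrite bin0n/= !mul0r expr0n.
case: b ab jb => [//|b]; rewrite !ltnS => ab jb.
have cb : ('C(b, j))%:R != 0 :> R by rewrite pnatr_eq0 -lt0n bin_gt0.
have binE c : ('C(c.+1, j.+1))%:R = c.+1%:R * ('C(c, j))%:R / j.+1%:R :> R.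
  by rewrite -natrM mul_bin_diag/= natrM mulrAC divff ?mul1r// pnatr_eq0.
have -> : ('C(a.+1, j.+1))%:R / ('C(b.+1, j.+1))%:R =
    (a.+1%:R / b.+1%:R) * (('C(a, j))%:R / ('C(b, j))%:R) :> R.
  by rewrite !binE; field; rewrite cb !nat1r !pnatr_eq0.
rewrite exprS ler_wpM2l//; apply: le_trans (IHj _ _ ab jb) _.
apply: lerXn2r; rewrite ?nnegrE//.
case: b ab {jb cb} => [|b] ab.
  by rewrite invr0 mulr0.
rewrite ler_pdivrMr// mulrAC ler_pdivlMr// -!natrM ler_nat; lia.
Qed.

(** A single pick falls in [B] with probability [b]. Any other mark makes at least two picks, the
    ball having two points, and these all fall in [B] with probability at most [b ^+ 2]. The bound
    is p 1 * b + (1 - p 1) * b ^ 2. *)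
Lemma sum_pick_weight_sub_le (R : realType) (n : nat) (x : 'I_n -> R * R) (r : R)
    (K : nat) (p : nat -> R) (u : 'I_n) (B : {set 'I_n}) (b := #|B :&: nbhd x r u|%:R / (rho x r u)%:R) :
  (1 < K)%N -> (forall k, 0 <= p k) -> p 0 = 0 -> \sum_(j < K.+1) p j = 1 ->
  (1 < rho x r u)%N ->
  \sum_(S : {set 'I_n} | S \subset B) pick_weight x r K p u S <=
    b * (1 - (1 - p 1) * (1 - b)) :> R.
Proof.
move=> K1 p0 p00 psum rho2; rewrite sum_pick_weight_sub.
have cardle : (#|B :&: nbhd x r u| <= rho x r u)%N by rewrite subset_leq_card// finset.subsetIr.
have rho0 : 0 < (rho x r u)%:R :> R by rewrite ltr0n; apply: ltn_trans rho2.
have b01 : 0 <= b <= 1.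
  by rewrite /b divr_ge0//= ler_pdivrMr// mul1r ler_nat.
have /andP[b0 b1] := b01.
pose one : 'I_K.+1 := inord 1.
have oneE : one = 1%N :> nat by rewrite inordK// ltnS ltnW.
have term (j : 'I_K.+1) : (0 < j)%N ->
    ('C(#|B :&: nbhd x r u|, minn j (rho x r u)))%:R /
    ('C(rho x r u, minn j (rho x r u)))%:R <= b ^+ (minn j (rho x r u)) :> R.
  by move=> j0; apply: bin_ratio_le => //; exact: geq_minr.
apply: (@le_trans _ _ (\sum_(j < K.+1) p j * (if j == one then b else b ^+ 2))).
  apply: ler_sum => j _; have [j0|j0] := posnP j; first by rewrite j0 p00 !mul0r.
  apply: ler_wpM2l => //; apply: le_trans (term j j0) _.
  case: eqP => [->|/eqP jn1].
    by rewrite oneE (minn_idPl _) ?expr1// ltnW.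
  apply: ler_wiXn2l => //; rewrite leq_min rho2 andbT.
  by move: jn1; rewrite -(inj_eq val_inj)/= oneE; case: (val j) j0 => [|[|]].
rewrite (bigD1 one)//= eqxx (eq_bigr (fun j : 'I_K.+1 => p j * b ^+ 2)); last first.
  by move=> j /negPf ->.
have -> : \sum_(j < K.+1 | j != one) p j * b ^+ 2 = (1 - p 1) * b ^+ 2.
  rewrite -mulr_suml; congr (_ * _).
  by apply/eqP; rewrite eq_sym subr_eq addrC -psum [X in X == _](bigD1 one)//= oneE.
by rewrite oneE le_eqVlt; apply/orP; left; apply/eqP; ring.
Qed.

(** Selections are independent over the vertices, and each vertex outside [V] contributes its total
    mass 1. *)
Lemma prob_all_subset (R : realType) (n : nat) (x : 'I_n -> R * R) (r : R)
    (K : nat) (p : nat -> R) (V : {set 'I_n}) (B : 'I_n -> {set 'I_n}) :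
  \sum_(j < K.+1) p j = 1 ->
  \sum_(Y : {ffun 'I_n -> {set 'I_n}}) (\prod_u pick_weight x r K p u (Y u)) *
    [forall u in V, Y u \subset B u]%:R =
  \prod_(u in V) \sum_(S : {set 'I_n} | S \subset B u) pick_weight x r K p u S.
Proof.
move=> psum; rewrite [RHS]big_mkcond/=.
transitivity (\prod_u \sum_(S : {set 'I_n}) pick_weight x r K p u S *
    ((u \in V) ==> (S \subset B u))%:R).
  rewrite bigA_distr_bigA/=; apply: eq_bigr => Y _.
  rewrite big_split/=; congr (_ * _).
  case: (boolP [forall u in V, _]) => [/forall_inP h|].
    by rewrite big1// => u _; case: (boolP (u \in V)) => //= uV; rewrite h.
  rewrite negb_forall => /existsP[u]; rewrite negb_imply => /andP[uV /negPf h].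
  by rewrite (bigD1 u)//= uV h mul0r.
apply: eq_bigr => u _; case: ifP => uV.
  rewrite [RHS]big_mkcond; apply: eq_bigr => S _ /=.
  by case: ifP => _; rewrite ?mulr1 ?mulr0.
by under eq_bigr do rewrite mulr1; exact: sum_pick_weight.
Qed.

(** * Counting the cuts of a region *)

Definition agree (R : realType) (n : nat) (nb : 'I_n -> {set 'I_n})
    (A : {set 'I_n}) (u : 'I_n) : R :=
  #|(if u \in A then A else ~: A) :&: nb u|%:R / #|nb u|%:R.

(** The least number of vertices of [W] that must change sides for [A] to be constant on [W] within
    each coarse cell. *)
Definition minority (I Q : finType) (cq : I -> Q) (W A : {set I}) : nat :=
  \sum_(q : Q) minn #|[set u in W | (cq u == q) && (u \in A)]|
                    #|[set u in W | (cq u == q) && (u \notin A)]|.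

Section RegionSum.
Variables (R : realType) (n : nat) (C Q : finType) (cf : 'I_n -> C) (T : rel C)
  (cq : 'I_n -> Q) (nb : 'I_n -> {set 'I_n}) (V1 V : {set 'I_n}) (eta L : R).
Hypothesis V1V : V1 \subset V.
Hypothesis L0 : 0 <= L.
Hypothesis eta0 : 0 <= eta.
Hypothesis nbT : forall u v, u \in V1 -> v \in nb u -> T (cf u) (cf v).
Hypothesis nb0 : forall u, u \in V1 -> (0 < #|nb u|)%N.
Hypothesis nbcard : forall u, u \in V1 ->
  #|[set v | T (cf u) (cf v)]|%:R <= (1 + eta) * #|nb u|%:R :> R.

Let cnt (c : C) : nat := #|[set v | cf v == c]|.

(* A bound for the factor of [u] when [(u \in A) = b], depending on [A] only
   through its cell counts [s] and the set [sg] of cells with majority in [A]. *)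
Let h (s : {ffun C -> 'I_n.+1}) (sg : {set Q}) (u : 'I_n) (b : bool) : R :=
  if u \in V1 then
    (if b then (\sum_(c | T (cf u) c) minn (s c) (cnt c))%N
     else (\sum_(c | T (cf u) c) (cnt c - s c))%N)%:R / #|nb u|%:R
  else if u \in V then expR (- L * (b != (cq u \in sg))%:R) else (~~ b)%:R.

Let h_ge0 s sg u b : 0 <= h s sg u b.
Proof. by rewrite /h; case: ifP => _; [rewrite divr_ge0|case: ifP => _; rewrite ?expR_ge0]. Qed.

(** In [V1] the two numerators add up to the number of points in the touched cells, at most 1 + eta
    times the ball. In the shell the two values are 1 and exp (- L), and outside [V] they are 0 and
    1. *)
Let h_sum s sg u : h s sg u true + h s sg u false <=
  expR (eta * (u \in V1)%:R + expR (- L) * (u \in V)%:R).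
Proof.
rewrite /h; case: (boolP (u \in V1)) => uV1.
  rewrite -mulrDl -natrD -big_split/= (fintype.subsetP V1V _ uV1) !mulr1.
  have -> : (\sum_(c | T (cf u) c) (minn (s c) (cnt c) + (cnt c - s c)) =
      #|[set v | T (cf u) (cf v)]|)%N.
    rewrite -sum1_card (partition_big cf (T (cf u)))/=; last by move=> v; rewrite inE.
    apply: eq_bigr => c Tc; rewrite minnE.
    transitivity (cnt c); first lia.
    rewrite /cnt -sum1_card; apply: eq_bigl => v; rewrite !inE.
    by case: eqP => [->|]; rewrite ?Tc ?andbF.
  apply: (@le_trans _ _ (1 + eta)).
    by rewrite ler_pdivrMr ?nbcard// ltr0n nb0.
  apply: le_trans (expR_ge1Dx eta) _; rewrite ler_expR lerDl.
  exact: expR_ge0.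
rewrite mulr0 add0r; case: ifP => uV; last by rewrite mulr0 expR0 add0r.
rewrite mulr1; case: (cq u \in sg); rewrite /= ?mulr0 ?mulr1 expR0 ?[_ + 1]addrC;
  exact: expR_ge1Dx.
Qed.

Let profile (A : {set 'I_n}) : {ffun C -> 'I_n.+1} :=
  [ffun c => inord #|[set v in A | cf v == c]|].
(** Ties go to [A]. Cells not met by [V] are left out, so that only [2 ^ #|cq @: V|] sets can
    occur. *)
Let major (A : {set 'I_n}) : {set Q} :=
  [set q in cq @: V | (#|[set u in V :\: V1 | (cq u == q) && (u \notin A)]| <=
     #|[set u in V :\: V1 | (cq u == q) && (u \in A)]|)%N].

Let profileE A c : profile A c = #|[set v in A | cf v == c]| :> nat.
Proof.
rewrite ffunE inordK// ltnS; apply: leq_trans (max_card _) _.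
by rewrite card_ord.
Qed.

Let profile_on (A : {set 'I_n}) : A \subset V ->
  profile A \in pffun_on ord0 (mem (cf @: V)) predT.
Proof.
move=> AV; apply/pffun_onP; split=> //; apply/supportP => c cV.
apply/val_inj; rewrite /= profileE; apply/eqP; rewrite cards_eq0.
apply/eqP/setP => v; rewrite !inE; apply/negP => /andP[vA /eqP vc].
by move: cV; rewrite -vc imset_f// (fintype.subsetP AV).
Qed.

Let minority_major (A : {set 'I_n}) :
  minority cq (V :\: V1) A =
  (\sum_(u in V :\: V1) ((u \in A) != (cq u \in major A)))%N.
Proof.
rewrite [RHS](partition_big cq predT)//=; apply: eq_bigr => q _.
have cntE (P : pred 'I_n) : (\sum_(u in V :\: V1 | cq u == q) P u =
    #|[set u in V :\: V1 | (cq u == q) && P u]|)%N.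
  rewrite -sum1_card big_mkcond [RHS]big_mkcond/=; apply: eq_bigr => u _.
  by rewrite !inE; case: (u \in V1); case: (u \in V); case: (cq u == q); case: (P u).
case: (boolP (q \in major A)) => qm.
  rewrite (eq_bigr (fun u => nat_of_bool ((u \in A) != true))); last first.
    by move=> u /andP[_ /eqP ->]; rewrite qm.
  rewrite (cntE (fun u => (u \in A) != true)).
  rewrite (minn_idPr _); first by apply: eq_card => u; rewrite !inE eqb_id.
  by move: qm; rewrite inE => /andP[].
rewrite (eq_bigr (fun u => nat_of_bool ((u \in A) != false))); last first.
  by move=> u /andP[_ /eqP ->]; rewrite (negPf qm).
rewrite (cntE (fun u => (u \in A) != false)).
have -> : [set u in V :\: V1 | (cq u == q) && ((u \in A) != false)] =
  [set u in V :\: V1 | (cq u == q) && (u \in A)].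
  by apply/setP => u; rewrite !inE eqbF_neg negbK.
apply/minn_idPl; move: qm; rewrite inE negb_and -ltnNge => /orP[qV|/ltnW//].
rewrite (_ : [set u in _ | _] = finset.set0) ?cards0//.
apply/setP => u; rewrite !inE; apply/negP => /andP[/andP[_ uV]] /andP[/eqP uq _].
by move: qV; rewrite -uq imset_f.
Qed.

(** The ball of a vertex of [V1] is covered by the cells it touches, whose counts on the side of
    that vertex are the numerators of [h]. Outside [V] the factor is 1, because [A] stays inside
    [V]. *)
Let term_le (A : {set 'I_n}) : A \subset V ->
  (\prod_(u in V1) agree R nb A u) * expR (- L * (minority cq (V :\: V1) A)%:R) <=
  \prod_u (if u \in A then h (profile A) (major A) u true
           else h (profile A) (major A) u false).
Proof.
move=> AV; rewrite minority_major natr_sum mulr_sumr expR_sum.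
have -> : \prod_u (if u \in A then h (profile A) (major A) u true
           else h (profile A) (major A) u false) =
  \prod_u h (profile A) (major A) u (u \in A).
  by apply: eq_bigr => u _; case: ifP.
rewrite big_mkcond [X in _ * X]big_mkcond -big_split/=.
apply: ler_prod => u _; apply/andP; split.
  apply: mulr_ge0; first by case: ifP => // _; rewrite /agree divr_ge0.
  by case: ifP => // _; rewrite expR_ge0.
rewrite /h inE; case: (boolP (u \in V1)) => uV1 /=; last first.
  rewrite mul1r; case: (boolP (u \in V)) => uV //=.
  by rewrite (contraNF (fintype.subsetP AV u) uV).
rewrite mulr1 /agree ler_pM2r ?invr_gt0 ?ltr0n ?nb0// ler_nat.
have cellsum (B : {set 'I_n}) : (#|B :&: nb u| <=
    \sum_(c | T (cf u) c) #|[set v in B | cf v == c]|)%N.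
  rewrite -sum1_card (partition_big cf (T (cf u)))/=; last first.
    by move=> v; rewrite inE => /andP[_]; exact: nbT.
  apply: leq_sum => c Tc; rewrite sum1_card; apply/subset_leq_card/fintype.subsetP => v.
  by rewrite !inE unfold_in/= => /andP[]; rewrite inE => /andP[-> _] ->.
case: ifP => uA; apply: leq_trans (cellsum _) _; apply: leq_sum => c Tc.
  rewrite profileE leq_min leqnn/= /cnt; apply/subset_leq_card/fintype.subsetP => v.
  by rewrite !inE => /andP[].
rewrite profileE /cnt leq_subRL; last first.
  by apply/subset_leq_card/fintype.subsetP => v; rewrite !inE => /andP[].
rewrite -cardsUI (_ : _ :&: _ = finset.set0) ?cards0 ?addn0; last first.
  by apply/setP => v; rewrite !inE; case: (v \in A); rewrite ?andbF.
by apply/subset_leq_card/fintype.subsetP => v; rewrite !inE => /orP[] /andP[].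
Qed.

(** For a fixed pair of a profile and a majority set, the bound of [term_le] is a product over the
    vertices in which [A] enters only through the membership of each vertex. Summing it over all [A]
    therefore gives a product of sums, bounded by [h_sum]; the prefactor counts the pairs. *)
Lemma region_sum :
  \sum_(A : {set 'I_n} | A \subset V)
    (\prod_(u in V1) agree R nb A u) * expR (- L * (minority cq (V :\: V1) A)%:R) <=
  (n.+1 ^ #|cf @: V| * 2 ^ #|cq @: V|)%:R *
    expR (eta * #|V1|%:R + expR (- L) * #|V|%:R).
Proof.
pose S := [set s : {ffun C -> 'I_n.+1} | s \in pffun_on ord0 (mem (cf @: V)) predT].
pose F s sg (A : {set 'I_n}) := \prod_u (if u \in A then h s sg u true else h s sg u false).
have F0 s sg A : 0 <= F s sg A by apply: prodr_ge0 => u _; case: ifP.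
apply: (@le_trans _ _ (\sum_(A : {set 'I_n}) \sum_(s in S)
    \sum_(sg in powerset (cq @: V)) F s sg A)).
  rewrite big_mkcond; apply: ler_sum => A _; case: ifP => [AV|_]; last first.
    by apply: sumr_ge0 => s _; apply: sumr_ge0.
  apply: le_trans (term_le AV) _.
  (* The pair belonging to [A] is among those summed, and all other terms are nonnegative. *)
  rewrite (bigD1 (profile A))/=; last by rewrite finset.in_set; exact: profile_on.
  rewrite (bigD1 (major A))/=; last first.
    by rewrite powersetE; apply/fintype.subsetP => q; rewrite inE => /andP[].
  rewrite -addrA lerDl addr_ge0//; first by apply: sumr_ge0.
  by apply: sumr_ge0 => s _; apply: sumr_ge0.
rewrite exchange_big/=.
apply: (@le_trans _ _ (\sum_(s in S) \sum_(sg in powerset (cq @: V))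
    expR (eta * #|V1|%:R + expR (- L) * #|V|%:R))).
  apply: ler_sum => s _; rewrite exchange_big/=; apply: ler_sum => sg _.
  have -> : \sum_(A : {set 'I_n}) F s sg A = \prod_u (h s sg u true + h s sg u false).
    by rewrite bigA_distr.
  apply: (@le_trans _ _ (\prod_u expR (eta * (u \in V1)%:R + expR (- L) * (u \in V)%:R))).
    by apply: ler_prod => u _; rewrite addr_ge0//= h_sum.
  rewrite -expR_sum big_split/= -!mulr_sumr -!natr_sum.
  have cE (W : {set 'I_n}) : (\sum_u (u \in W) = #|W|)%N.
    by rewrite -sum1_card [RHS]big_mkcond/=; apply: eq_bigr => u _; case: (u \in W).
  by rewrite !cE.
rewrite !sumr_const -mulrnA -[leLHS]mulr_natl card_powerset mulnC.
rewrite (_ : #|S| = n.+1 ^ #|cf @: V|)%N//.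
rewrite /S cardsE card_pffun_on; congr (_ ^ _)%N.
by rewrite -[RHS]card_ord; apply: eq_card.
Qed.

End RegionSum.

(** * Balanced cuts and discordance *)

Definition edge_closed (n : nat) (e : rel 'I_n) (A : {set 'I_n}) : bool :=
  [forall u, forall v, e u v ==> ((u \in A) == (v \in A))].

Lemma C1_ge (n : nat) (e : rel 'I_n) (u : 'I_n) : (#|[set v | connect e u v]| <= C1 e)%N.
Proof.
rewrite /C1; apply: leq_trans (leq_bigmax u); rewrite leq_eqVlt; apply/orP; left.
(* The component is a classical set in [C1] and a finite set here; both have the same elements. *)
apply/eqP/eq_card => v; rewrite !inE; apply/idP/idP => [h|]; first exact/mem_set.
by move/set_mem.
Qed.

Lemma edge_closed_component (n : nat) (e : rel 'I_n) (u : 'I_n) : symmetric e ->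
  edge_closed e [set v | connect e u v].
Proof.
move=> esym; apply/forallP => v; apply/forallP => w; apply/implyP => evw.
rewrite !inE; apply/eqP; apply/idP/idP => h; apply: connect_trans h (connect1 _) => //.
by rewrite esym.
Qed.

(** Take a largest closed set [A] of size at most (1 - eps / 3) n. If it had fewer than eps n / 3
    vertices, adding the component [D] of an outside vertex would exceed the upper limit by
    maximality. But [D] is itself admissible, so |D| <= |A| and the union has fewer than 2 eps n / 3
    vertices. *)
Lemma exists_balanced_cut (R : realType) (n : nat) (e : rel 'I_n) (eps : R) :
  symmetric e -> 0 < eps < 1 -> (C1 e)%:R < (1 - eps) * n%:R ->
  exists A : {set 'I_n}, [/\ edge_closed e A,
    eps / 3 * n%:R <= #|A|%:R & #|A|%:R <= (1 - eps / 3) * n%:R].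
Proof.
move=> esym /andP[eps0 eps1] hC1.
have n0 : 0 <= n%:R :> R by [].
have compP u : #|[set v | connect e u v]|%:R < (1 - eps) * n%:R.
  by apply: le_lt_trans hC1; rewrite ler_nat C1_ge.
pose P (A : {set 'I_n}) := edge_closed e A && (#|A|%:R <= (1 - eps / 3) * n%:R).
have epsn : 0 <= eps * n%:R by rewrite mulr_ge0// ltW.
have en : eps * n%:R <= n%:R by rewrite ler_piMl// ltW.
have P0 : P finset.set0.
  rewrite /P cards0; apply/andP; split; last by lra.
  by apply/forallP => u; apply/forallP => v; rewrite !inE implybT.
case: (arg_maxnP (fun A : {set 'I_n} => #|A|) P0) => A /andP[Acl Aup] Amax.
have [lowA|lowA] := lerP (eps / 3 * n%:R) #|A|%:R; first by exists A.
have [u uA] : exists u, u \notin A.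
  apply/existsP; rewrite -negb_forall; apply/negP => /forallP h.
  have : #|A| = n by rewrite -[RHS]card_ord; apply: eq_card => v; rewrite h.
  by move=> An; move: lowA; rewrite An; lra.
pose D := [set v | connect e u v]; have Dcl : edge_closed e D := edge_closed_component u esym.
have uD : u \in D by rewrite inE connect0.
have PD : P D by rewrite /P Dcl/=; have := compP u; rewrite -/D; lra.
have UDcl : edge_closed e (A :|: D).
  apply/forallP => v; apply/forallP => w; apply/implyP => evw; rewrite !finset.in_setU.
  move/forallP/(_ v)/forallP/(_ w)/implyP/(_ evw)/eqP: Acl => ->.
  by move/forallP/(_ v)/forallP/(_ w)/implyP/(_ evw)/eqP: Dcl => ->.
have AUD : (#|A| < #|A :|: D|)%N.
  rewrite proper_card// properE finset.subsetUl/=; apply/fintype.subsetPn.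
  by exists u => //; rewrite finset.in_setU uD orbT.
have UDbig : (1 - eps / 3) * n%:R < #|A :|: D|%:R.
  rewrite ltNge; apply/negP => UDup; have : P (A :|: D) by rewrite /P UDcl.
  by move/Amax => /=; rewrite leqNgt AUD.
have DA : (#|D| <= #|A|)%N by exact: Amax.
have : #|A :|: D|%:R <= #|A|%:R + #|D|%:R :> R by rewrite -natrD ler_nat leq_card_setU.
have : #|D|%:R <= #|A|%:R :> R by rewrite ler_nat.
by move=> h1 h2; exfalso; lra.
Qed.

Definition side (n : nat) (A : {set 'I_n}) (u : 'I_n) : {set 'I_n} :=
  if u \in A then A else ~: A.

(** The quantity g_u of the overview; [agree] is 1 - g_u. *)
Definition disagree (R : realType) (n : nat) (nb : 'I_n -> {set 'I_n})
    (A : {set 'I_n}) (u : 'I_n) : R := #|nb u :\: side A u|%:R / #|nb u|%:R.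

Lemma agreeE (R : realType) (n : nat) (nb : 'I_n -> {set 'I_n}) (A : {set 'I_n}) u :
  (0 < #|nb u|)%N -> agree R nb A u = 1 - disagree R nb A u.
Proof.
move=> nb0; have nb0R : #|nb u|%:R != 0 :> R by rewrite pnatr_eq0 -lt0n.
apply/eqP; rewrite eq_sym subr_eq; apply/eqP.
rewrite /agree /disagree -mulrDl -natrD -/(side A u) finset.setIC.
by rewrite cardsID divff.
Qed.

Lemma side_irr (n : nat) (Y : {ffun 'I_n -> {set 'I_n}}) (A : {set 'I_n}) u :
  edge_closed (irr_edge Y) A -> Y u \subset side A u.
Proof.
move=> /forallP/(_ u)/forallP Acl; apply/fintype.subsetP => v vY.
have [->|uv] := eqVneq v u; first by rewrite /side; case: ifP => // /negbT; rewrite inE.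
move/implyP: (Acl v); rewrite /irr_edge eq_sym uv vY => /(_ isT)/eqP uvA.
by rewrite /side uvA; case: ifP => // /negbT; rewrite inE.
Qed.

Lemma irr_edge_sym (n : nat) (Y : {ffun 'I_n -> {set 'I_n}}) : symmetric (irr_edge Y).
Proof. by move=> u v; rewrite /irr_edge eq_sym orbC. Qed.

(** * Discordant cells and the growth of discordance around them *)

Section LocalStructure.
Variables (R : realType) (n : nat) (Q : finType) (cq : 'I_n -> Q)
  (nb : 'I_n -> {set 'I_n}) (B : Q -> nat -> {set Q}) (adj : rel Q)
  (mu K0 : R) (P : nat -> nat).
Hypothesis mu0 : 0 < mu.
Hypothesis K00 : 0 < K0.
Hypothesis B0 : forall q, B q 0 = [set q]%SET.
Hypothesis Bmono : forall q k, B q k \subset B q k.+1.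
Hypothesis Bnb : forall q k u v, cq u \in B q k -> v \in nb u -> cq v \in B q k.+1.
Hypothesis adjxx : forall q, adj q q.
Hypothesis adj_nb : forall u v, adj (cq u) (cq v) -> v \in nb u.
Hypothesis adj_conn : forall S : {set Q},
  (forall q q', adj q q' -> q \in S -> q' \in S) -> forall q q', q \in S -> q' \in S.
Hypothesis cntlo : forall q, mu / 2 <= #|[set u | cq u == q]|%:R.
Hypothesis cnthi : forall q, #|[set u | cq u == q]|%:R <= 2 * mu.
Hypothesis nbhi : forall u, #|nb u|%:R <= K0 * mu.
Hypothesis Bcard : forall q k, (#|B q k| <= P k)%N.
Hypothesis Qn : #|Q|%:R * mu = n%:R.

Definition block q k : {set 'I_n} := [set u | cq u \in B q k].
Let inA (A : {set 'I_n}) q : R := #|[set u | (cq u == q) && (u \in A)]|%:R.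
Let outA (A : {set 'I_n}) q : R := #|[set u | (cq u == q) && (u \notin A)]|%:R.
Definition discord (A : {set 'I_n}) q k : R := \sum_(u in block q k) disagree R nb A u.

Let nb_gt0 u : (0 < #|nb u|)%N.
Proof. by apply/card_gt0P; exists u; apply: adj_nb; exact: adjxx. Qed.

Let dis_ge0 A u : 0 <= disagree R nb A u.
Proof. by rewrite divr_ge0. Qed.

Let dis_le1 A u : disagree R nb A u <= 1.
Proof.
by rewrite ler_pdivrMr ?ltr0n ?nb_gt0// mul1r ler_nat subset_leq_card// finset.subsetDl.
Qed.

Lemma card_block q k : #|block q k|%:R <= 2 * mu * (P k)%:R.
Proof.
have -> : #|block q k| = (\sum_(q' in B q k) #|[set u | cq u == q']|)%N.
  rewrite -sum1_card (partition_big cq (mem (B q k)))/=; last by move=> u; rewrite inE.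
  apply: eq_bigr => q' hq'; rewrite -sum1_card; apply: eq_bigl => u; rewrite !inE.
  by case: eqP => [->|]; rewrite ?andbF// hq'.
rewrite natr_sum; apply: (@le_trans _ _ (\sum_(q' in B q k) (2 * mu))).
  by apply: ler_sum => q' _; exact: cnthi.
rewrite sumr_const -[leLHS]mulr_natr ler_wpM2l ?ler_nat ?Bcard//.
by rewrite mulr_ge0// ltW.
Qed.

Let inoutA A q : inA A q + outA A q = #|[set u | cq u == q]|%:R.
Proof.
rewrite -natrD; congr (_%:R).
rewrite -[RHS](cardsID A); congr (_ + _)%N; apply: eq_card => u; rewrite !inE//.
by rewrite andbC.
Qed.

(** The ball of a vertex of [q] contains all of [q'], hence every point of [q'] on the other side,
    and has at most [K0 * mu] points. *)
Lemma cell_disagree A q q' : adj q q' ->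
  (inA A q * outA A q' + outA A q * inA A q') / (K0 * mu) <=
  \sum_(u | cq u == q) disagree R nb A u.
Proof.
move=> aqq'; have Km0 : 0 < K0 * mu by rewrite mulr_gt0.
have dlow u : cq u == q ->
    (if u \in A then outA A q' else inA A q') / (K0 * mu) <= disagree R nb A u.
  move=> /eqP uq; rewrite /disagree ler_pdivrMr// mulrAC ler_pdivlMr ?ltr0n ?nb_gt0//.
  apply: ler_pM => //; first by case: ifP.
  rewrite /side; case: ifP => uA; rewrite ler_nat; apply/subset_leq_card/fintype.subsetP => v;
    rewrite !inE => /andP[/eqP vq vA]; rewrite ?vA/=; apply: adj_nb;
    by rewrite uq vq.
apply: le_trans (ler_sum _ dlow); rewrite -mulr_suml.
rewrite ler_pM2r ?invr_gt0// (bigID (mem A))/=.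
rewrite [X in _ <= X + _](eq_bigr (fun=> outA A q')); last by move=> u /andP[_ ->].
rewrite [X in _ <= _ + X](eq_bigr (fun=> inA A q')); last by move=> u /andP[_ /negPf ->].
rewrite !sumr_const -[X in _ <= X + _]mulr_natl -[X in _ <= _ + X]mulr_natl.
by rewrite /inA /outA !cardsE.
Qed.

(** Apply [cell_disagree] to [q] and itself: the larger of the two counts is at least mu / 4, so
    their product controls mu times the smaller one. *)
Lemma minority_le A q :
  Num.min (inA A q) (outA A q) <= 2 * K0 * \sum_(u | cq u == q) disagree R nb A u.
Proof.
have Km0 : 0 < K0 * mu by rewrite mulr_gt0.
have := cell_disagree A (adjxx q); set S := \sum_(u | _) _ => h.
have := inoutA A q; have := cntlo q; have i0 : 0 <= inA A q by []; have o0 : 0 <= outA A q by [].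
move: h i0 o0; move: (inA A q) (outA A q) (#|_|%:R) => a b N.
rewrite ler_pdivrMr// => h a0 b0 hN abN.
have S0 : 0 <= S by apply: sumr_ge0.
have : Num.min a b * (mu / 2) <= 2 * (a * b).
  rewrite /Num.min; case: ltP => ab; have : mu/2 <= 2 * Num.max a b.
  - by rewrite /Num.max ab; lra.
  - by rewrite /Num.max ab => hb; nra.
  - by rewrite /Num.max ltNge ab/=; lra.
  - by rewrite /Num.max ltNge ab/= => hb; nra.
move=> hm; have : Num.min a b * mu <= 2 * K0 * S * mu by nra.
by rewrite ler_pM2r.
Qed.

(** The shell is a union of whole coarse cells, so [minority_le] can be summed over them. *)
Lemma discordS A q k :
  (minority cq (block q k.+1 :\: block q k) A)%:R <=
  2 * K0 * (discord A q k.+1 - discord A q k).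
Proof.
have -> : discord A q k.+1 - discord A q k =
    \sum_(u in block q k.+1 :\: block q k) disagree R nb A u.
  apply/eqP; rewrite subr_eq addrC /discord.
  rewrite [X in X == _](big_setID (block q k))/= (finset.setIidPr _)//.
  by apply/fintype.subsetP => u; rewrite !inE; apply/fintype.subsetP/Bmono.
rewrite /minority natr_sum [X in _ <= _ * X](partition_big cq predT)//= mulr_sumr.
apply: ler_sum => q' _.
case: (boolP (q' \in B q k.+1 :\: B q k)) => hq'.
  rewrite [X in _ <= _ * X](eq_bigl (fun u => cq u == q')); last first.
    move=> u; rewrite !inE; case: eqP => [->|]; rewrite ?andbF//.
    by move: hq'; rewrite inE andbT.
  apply: le_trans (minority_le A q').
  rewrite le_min; apply/andP; split; rewrite ler_nat;
    [apply: leq_trans (geq_minl _ _) _|apply: leq_trans (geq_minr _ _) _];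
    apply/subset_leq_card/fintype.subsetP => u;
    by rewrite !inE => /and3P[_ -> ->].
rewrite (_ : [set u in _ | (_ == q') && (u \in A)] = finset.set0) ?cards0 ?min0n; last first.
  apply/setP => u; rewrite !inE; apply/negP => /andP[h1 /andP[/eqP h2 _]].
  by move: hq'; rewrite -h2 inE h1.
by rewrite !mulr_ge0 ?sumr_ge0// ltW.
Qed.

(** Without a seed every cell is nearly pure, its minority being below theta mu. Adjacent cells with
    opposite majorities would have majority counts of at least mu / 4 each, whose product (mu / 4) ^
    2 is the source of the 16. By connectivity all cells then have the same majority, and [A] or its
    complement has at most theta n points. *)
Lemma discord0_seed (A : {set 'I_n}) (theta : R) : 0 < theta <= 4^-1 ->
  theta * n%:R < #|A|%:R -> theta * n%:R < n%:R - #|A|%:R ->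
  exists q, theta / (16 * K0) * mu <= discord A q 0.
Proof.
move=> /andP[th0 th4] Alo Ahi; apply: contrapT => nex.
have small q : \sum_(u | cq u == q) disagree R nb A u < theta / (16 * K0) * mu.
  rewrite ltNge; apply/negP => h; apply: nex; exists q; apply: le_trans h _.
  by rewrite /discord /block B0 le_eqVlt; apply/orP; left; apply/eqP; apply: eq_bigl => u; rewrite !inE.
have eqK : theta / (16 * K0) * mu * (2 * K0) = theta * mu / 8.
  by field; rewrite gt_eqF.
have pure q : inA A q < theta * mu \/ outA A q < theta * mu.
  have : Num.min (inA A q) (outA A q) < theta * mu.
    apply: le_lt_trans (minority_le A q) _; rewrite mulrC.
    apply: (@lt_le_trans _ _ (theta / (16 * K0) * mu * (2 * K0))).
      by rewrite ltr_pM2r ?mulr_gt0.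
    by have := mulr_gt0 th0 mu0; rewrite eqK; lra.
  by rewrite gt_min => /orP[]; [left|right].
have thmu : theta * mu <= mu / 4 by rewrite mulrC ler_wpM2l// ltW.
pose S := [set q | inA A q < theta * mu].
have Scl q q' : adj q q' -> q \in S -> q' \in S.
  move=> aqq'; rewrite !inE => hq; case: (pure q') => // hq'; exfalso.
  have := cell_disagree A aqq'; rewrite leNgt; move/negP; apply.
  apply: lt_le_trans (small q) _.
  rewrite ler_pdivlMr ?mulr_gt0//.
  have h1 : mu / 4 <= outA A q by have := inoutA A q; have := cntlo q; lra.
  have h2 : mu / 4 <= inA A q' by have := inoutA A q'; have := cntlo q'; lra.
  have -> : theta / (16 * K0) * mu * (K0 * mu) = theta * (mu / 4 * (mu / 4)).
    by field; rewrite gt_eqF.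
  have m4 : 0 <= mu / 4 by rewrite divr_ge0// ltW.
  have : mu / 4 * (mu / 4) <= outA A q * inA A q' by apply: ler_pM.
  have : 0 <= inA A q * outA A q' by rewrite mulr_ge0.
  have : theta * (mu / 4 * (mu / 4)) <= mu / 4 * (mu / 4).
    by apply: ler_piMl; [rewrite mulr_ge0|lra].
  lra.
have sumin : #|A|%:R = \sum_q inA A q.
  rewrite -natr_sum; congr (_%:R); rewrite -sum1_card (partition_big cq predT)//=.
  by apply: eq_bigr => q _; rewrite -sum1_card; apply: eq_bigl => u; rewrite !inE andbC.
have sumout : n%:R - #|A|%:R = \sum_q outA A q.
  apply/eqP; rewrite subr_eq addrC sumin -big_split/=.
  rewrite (eq_bigr (fun q => #|[set u | cq u == q]|%:R)); last by move=> q _; rewrite inoutA.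
  rewrite -natr_sum; apply/eqP; congr (_%:R); rewrite -[LHS]card_ord -sum1_card.
  rewrite (partition_big cq predT)//=.
  by apply: eq_bigr => q _; rewrite -sum1_card; apply: eq_bigl => u; rewrite !inE.
have lim (f : Q -> R) : (forall q, f q <= theta * mu) -> \sum_q f q <= theta * n%:R.
  move=> h; apply: le_trans (ler_sum _ (fun q _ => h q)) _.
  by rewrite sumr_const -[leLHS]mulr_natr -Qn mulrAC mulrA.
case: (pselect (exists q, q \in S)) => [[q qS]|nS].
  move: Alo; rewrite sumin ltNge lim// => q'.
  by have := adj_conn Scl q' qS; rewrite inE => /ltW.
move: Ahi; rewrite sumout ltNge lim// => q'.
case: (pure q') => [h|/ltW//]; exfalso; apply: nS; exists q'.
by rewrite inE.
Qed.

(** If every k failed, [discordS] would make the discordance grow by the factor 1 + c / (2 K0 L) at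
    each step, until it exceeded the number of vertices of the block. *)
Lemma discord_pigeonhole A q (Rr : nat) (L c delta : R) : 0 < L -> 0 < c -> 0 < delta ->
  delta * mu <= discord A q 0 ->
  2 * (P Rr)%:R < (1 + c / (2 * K0 * L)) ^+ Rr * delta ->
  exists2 k, (k < Rr)%N & delta * mu <= discord A q k /\
    L * (minority cq (block q k.+1 :\: block q k) A)%:R <= c * discord A q k.
Proof.
move=> L0 c0 d0 hd hR; apply: contrapT => nex.
set z := c / (2 * K0 * L); have z0 : 0 < z by rewrite divr_gt0 ?mulr_gt0.
have main k : (k <= Rr)%N -> (1 + z) ^+ k * (delta * mu) <= discord A q k.
  elim: k => [|k IHk] kR; first by rewrite mul1r.
  have IH := IHk (ltnW kR).
  have gk : delta * mu <= discord A q k.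
    apply: le_trans IH; apply: ler_peMl; first by rewrite mulr_ge0// ltW.
    by rewrite exprn_ege1// lerDl ltW.
  have hk : c * discord A q k < L * (minority cq (block q k.+1 :\: block q k) A)%:R.
    by rewrite ltNge; apply/negP => h; apply: nex; exists k.
  have := discordS A q k; set m := (minority _ _ _)%:R in hk * => hm.
  have step : z * discord A q k <= discord A q k.+1 - discord A q k.
    rewrite /z mulrAC ler_pdivrMr ?mulr_gt0//.
    have : L * m <= L * (2 * K0 * (discord A q k.+1 - discord A q k)) by rewrite ler_pM2l.
    lra.
  rewrite exprS -mulrA mulrDl mul1r.
  have : z * ((1 + z) ^+ k * (delta * mu)) <= z * discord A q k by rewrite ler_pM2l.
  lra.
have := main _ (leqnn Rr); have : discord A q Rr <= 2 * mu * (P Rr)%:R.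
  apply: le_trans (card_block q Rr).
  apply: le_trans (ler_sum _ (fun u _ => dis_le1 A u)) _.
  by rewrite sumr_const.
move=> h1 h2; have := le_trans h2 h1.
rewrite mulrA [2 * mu * _]mulrAC ler_pM2r// => h3.
by move: (lt_le_trans hR h3); rewrite ltxx.
Qed.

End LocalStructure.

(** * The conditional probability given the points *)

Section ConditionalBound.
Variables (R : realType) (n : nat) (x : 'I_n -> R * R) (r : R)
  (K : nat) (p : nat -> R) (eps : R).
Variables (Q : finType) (cq : 'I_n -> Q) (B : Q -> nat -> {set Q}) (adj : rel Q)
  (mu K0 : R) (P : nat -> nat).
Variables (C : finType) (cf : 'I_n -> C) (T : rel C) (F Rr : nat) (eta L delta : R).
Let nb := nbhd x r.
Let c := 1 - p 1.
Hypothesis K1 : (1 < K)%N.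
Hypothesis p0 : forall k, 0 <= p k.
Hypothesis p00 : p 0 = 0.
Hypothesis psum : \sum_(j < K.+1) p j = 1.
Hypothesis c0 : 0 < c.
Hypothesis eps01 : 0 < eps < 1.
Hypothesis mu0 : 0 < mu.
Hypothesis K00 : 0 < K0.
Hypothesis B0 : forall q, B q 0 = [set q]%SET.
Hypothesis Bmono : forall q k, B q k \subset B q k.+1.
Hypothesis Bnb : forall q k u v, cq u \in B q k -> v \in nb u -> cq v \in B q k.+1.
Hypothesis adjxx : forall q, adj q q.
Hypothesis adj_nb : forall u v, adj (cq u) (cq v) -> v \in nb u.
Hypothesis adj_conn : forall S : {set Q},
  (forall q q', adj q q' -> q \in S -> q' \in S) -> forall q q', q \in S -> q' \in S.
Hypothesis cntlo : forall q, mu / 2 <= #|[set u | cq u == q]|%:R.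
Hypothesis cnthi : forall q, #|[set u | cq u == q]|%:R <= 2 * mu.
Hypothesis nbhi : forall u, #|nb u|%:R <= K0 * mu.
Hypothesis Bcard : forall q k, (#|B q k| <= P k)%N.
Hypothesis Pmono : forall k, (k <= Rr)%N -> (P k <= P Rr)%N.
Hypothesis Qn : #|Q|%:R * mu = n%:R.
Hypothesis L0 : 0 < L.
Hypothesis eta0 : 0 <= eta.
Hypothesis nbT : forall u v, v \in nb u -> T (cf u) (cf v).
Hypothesis nbcard : forall u,
  #|[set v | T (cf u) (cf v)]|%:R <= (1 + eta) * #|nb u|%:R :> R.
Hypothesis nb2 : forall u, (1 < #|nb u|)%N.
Hypothesis cfcard : forall q k, (k <= Rr)%N -> (#|cf @: block cq B q k| <= F)%N.
(* eps / 3 is halved to make the inequalities strict in [discord0_seed], whose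
   threshold is theta / (16 * K0). *)
Hypothesis deltaE : delta = eps / (96 * K0).
Hypothesis RrE : 2 * (P Rr)%:R < (1 + c / (4 * K0 * L)) ^+ Rr * delta.
Hypothesis etaL : 2 * (P Rr)%:R * (eta + expR (- L)) <= c * delta / 4.

Let V q k := block cq B q k.
Let G A q k := discord R cq nb B A q k.
Let W (Y : {ffun 'I_n -> {set 'I_n}}) := \prod_u pick_weight x r K p u (Y u).
(** The shell may use up at most half of the gain c G; the other half pays for the counting. *)
Let seeded (A : {set 'I_n}) q k := (delta * mu <= G A q k) &&
  (L * (minority cq (V q k.+1 :\: V q k) A)%:R <= c / 2 * G A q k).
Let obeys (A : {set 'I_n}) (U : {set 'I_n}) (Y : {ffun 'I_n -> {set 'I_n}}) :=
  [forall u in U, Y u \subset side A u].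

Let delta0 : 0 < delta.
Proof. by rewrite deltaE divr_gt0 ?mulr_gt0//; case/andP: eps01. Qed.

Let W_ge0 Y : 0 <= W Y.
Proof. by apply: prodr_ge0 => u _; apply: pick_weight_ge0. Qed.

Let W_nb Y u : W Y != 0 -> Y u \subset nb u.
Proof.
apply: contraNT => h; rewrite /W (bigD1 u)//= mulf_eq0; apply/orP; left.
by apply/eqP; rewrite /pick_weight big1// => j _; rewrite (negPf h) mulr0.
Qed.

Let V_sub q k : V q k \subset V q k.+1.
Proof.
apply/fintype.subsetP => u; rewrite !inE; exact: (fintype.subsetP (Bmono q k)).
Qed.

Let nb_V q k u : u \in V q k -> nb u \subset V q k.+1.
Proof.
by rewrite inE => uV; apply/fintype.subsetP => v vu; rewrite inE; apply: Bnb vu.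
Qed.

(** Balls around [V q k] stay in [V q k.+1], so only the trace of the cut on that region matters.
    The union bound can thus run over subsets of the region instead of global cuts. *)
Let localize A q k : let A' := A :&: V q k.+1 in
  [/\ forall u v, u \in V q k -> v \in nb u -> (v \in side A' u) = (v \in side A u),
      G A' q k = G A q k &
      minority cq (V q k.+1 :\: V q k) A' = minority cq (V q k.+1 :\: V q k) A].
Proof.
move=> A'.
have memV u : u \in V q k.+1 -> (u \in A') = (u \in A) by move=> uV; rewrite finset.in_setI uV andbT.
have sideE u v : u \in V q k -> v \in nb u -> (v \in side A' u) = (v \in side A u).
  move=> uV vu; rewrite /side memV ?(fintype.subsetP (V_sub q k))//.
  have vA := memV v (fintype.subsetP (nb_V uV) _ vu).
  by case: ifP => _; rewrite ?finset.in_setC vA.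
split=> //.
  apply: eq_bigr => u uV; rewrite /disagree; congr (_%:R / _).
  apply: eq_card => v; rewrite !finset.in_setD; case: (boolP (v \in nb u)) => vu; rewrite ?andbF//.
  by rewrite sideE.
apply: eq_bigr => q' _; congr minn; apply: eq_card => u; rewrite !inE;
  by case: (cq u \in B q k.+1); rewrite ?andbF// ?andbT.
Qed.

Let bad_cover Y : W Y != 0 -> (C1 (irr_edge Y))%:R < (1 - eps) * n%:R ->
  exists q (k : 'I_Rr) (A : {set 'I_n}),
    [/\ A \subset V q k.+1, seeded A q k & obeys A (V q k) Y].
Proof.
move=> WY bad; have [A [Acl Alo Ahi]] := exists_balanced_cut (@irr_edge_sym _ Y) eps01 bad.
have n0 : 0 < n%:R :> R.
  rewrite ltr0n lt0n; apply/negP => /eqP n0; move: bad.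
  by rewrite [X in _ * X%:R]n0 mulr0 ltNge ler0n.
have /andP[e0 e1] := eps01.
have en : 0 < eps * n%:R by rewrite mulr_gt0.
have th : 0 < eps / 6 <= 4^-1 by apply/andP; split; lra.
have [||q hq] := @discord0_seed R n Q cq nb B adj mu K0 mu0 K00 B0 adjxx adj_nb
  adj_conn cntlo nbhi Qn A (eps / 6) th; [lra|lra|].
have dE : eps / 6 / (16 * K0) = delta by rewrite deltaE; field; rewrite gt_eqF.
rewrite dE in hq.
(* The pigeonhole is used with c / 2, as [seeded] demands. *)
have RrE2 : 2 * (P Rr)%:R < (1 + c / 2 / (2 * K0 * L)) ^+ Rr * delta.
  by have -> : c / 2 / (2 * K0 * L) = c / (4 * K0 * L) by field; rewrite !gt_eqF.
have c20 : 0 < c / 2 by rewrite divr_gt0.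
have [k kR [hk1 hk2]] := @discord_pigeonhole R n Q cq nb B adj mu K0 P mu0 K00 Bmono
  adjxx adj_nb cntlo cnthi nbhi Bcard A q Rr L (c / 2) delta L0 c20 delta0 hq RrE2.
have [hside hG hmin] := localize A q k.
exists q, (Ordinal kR), (A :&: V q k.+1); split; first exact: finset.subsetIr.
  by rewrite /seeded hG hmin hk1.
apply/forall_inP => u uV; apply/fintype.subsetP => v vY.
rewrite hside//; last exact: (fintype.subsetP (W_nb u WY)).
exact: (fintype.subsetP (side_irr u Acl)).
Qed.

(** Independence reduces this to single vertices, where 1 - c g <= exp (- c g). *)
Let prob_obeys (A : {set 'I_n}) (U : {set 'I_n}) :
  \sum_Y W Y * (obeys A U Y)%:R <=
  (\prod_(u in U) agree R nb A u) * expR (- c * \sum_(u in U) disagree R nb A u).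
Proof.
rewrite prob_all_subset// mulr_sumr expR_sum -big_split/=.
apply: ler_prod => u _; apply/andP; split.
  by apply: sumr_ge0 => S _; apply: pick_weight_ge0.
apply: le_trans (sum_pick_weight_sub_le _ K1 p0 p00 psum (nb2 u)) _.
rewrite -/nb -/(rho x r u) -/(agree R nb A u).
have a0 : 0 <= agree R nb A u by rewrite divr_ge0.
apply: ler_wpM2l => //.
rewrite agreeE ?(ltn_trans _ (nb2 u))//.
apply: le_trans (expR_ge1Dx _).
by rewrite le_eqVlt /c; apply/orP; left; apply/eqP; ring.
Qed.

(** For a seeded cut, - c G is at most - c delta mu / 2 minus L times the minority. [region_sum]
    absorbs the minority term and, by [etaL], costs at most exp (c delta mu / 4), which leaves exp
    (- c delta mu / 4). *)
Let region_bound q (k : 'I_Rr) :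
  \sum_(A : {set 'I_n} | (A \subset V q k.+1) && seeded A q k)
    \sum_Y W Y * (obeys A (V q k) Y)%:R <=
  (n.+1 ^ F * 2 ^ P Rr)%:R * expR (- (c * delta * mu / 4)).
Proof.
pose E0 := expR (- (c * delta * mu / 2)).
apply: (@le_trans _ _ (E0 * \sum_(A : {set 'I_n} | A \subset V q k.+1)
  (\prod_(u in V q k) agree R nb A u) *
  expR (- L * (minority cq (V q k.+1 :\: V q k) A)%:R))).
  rewrite mulr_sumr big_mkcondr/=; apply: ler_sum => A AV.
  have pa0 : 0 <= \prod_(u in V q k) agree R nb A u.
    by apply: prodr_ge0 => u _; rewrite divr_ge0.
  case: ifP => [/andP[h1 h2]|_]; last by rewrite !mulr_ge0// expR_ge0.
  apply: le_trans (prob_obeys A (V q k)) _.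
  rewrite mulrCA; apply: ler_wpM2l => //.
  rewrite -expRD ler_expR -/(discord R cq nb B A q k) -/(G A q k).
  have : c * (delta * mu) <= c * G A q k by rewrite ler_pM2l.
  lra.
have kR : (k.+1 <= Rr)%N by [].
have region := @region_sum R n C Q cf T cq nb (V q k) (V q k.+1) eta L (V_sub q k)
   (ltW L0) eta0 (fun u v _ => @nbT u v) (fun u _ => ltn_trans (ltn0Sn _) (nb2 u)) (fun u _ => nbcard u).
apply: le_trans (ler_wpM2l (expR_ge0 _) region) _.
rewrite mulrCA; apply: ler_pM => //.
  rewrite ler_nat; apply: leq_mul; first by apply: leq_pexp2l => //; exact: cfcard.
  apply: leq_pexp2l => //; apply: leq_trans (leq_trans (Bcard q k.+1) (Pmono kR)).
  apply: subset_leq_card; apply/fintype.subsetP => q' /imsetP[u].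
  by rewrite inE => ? ->.
rewrite /E0 -expRD ler_expR.
have cV : #|V q k.+1|%:R <= 2 * mu * (P Rr)%:R.
  apply: le_trans (@card_block R n Q cq B mu P mu0 cnthi Bcard q k.+1) _.
  by rewrite ler_pM2l ?mulr_gt0// ler_nat Pmono.
have cV' : #|V q k|%:R <= 2 * mu * (P Rr)%:R.
  by apply: le_trans cV; rewrite ler_nat subset_leq_card.
have h1 : eta * #|V q k|%:R <= eta * (2 * mu * (P Rr)%:R) by rewrite ler_wpM2l.
have h2 : expR (- L) * #|V q k.+1|%:R <= expR (- L) * (2 * mu * (P Rr)%:R).
  by rewrite ler_wpM2l ?expR_ge0.
have h3 : mu * (2 * (P Rr)%:R * (eta + expR (- L))) <= mu * (c * delta / 4).
  by rewrite ler_pM2l.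
lra.
Qed.

Lemma cond_prob_lower : 1 - cond_prob x r K p eps <=
  #|Q|%:R * Rr%:R * ((n.+1 ^ F * 2 ^ P Rr)%:R * expR (- (c * delta * mu / 4))).
Proof.
have W1 : \sum_Y W Y = 1.
  have := prob_all_subset x r finset.set0 (fun=> finset.set0) psum; rewrite big_set0 => <-.
  apply: eq_bigr => Y _; rewrite (_ : [forall u in _, _]) ?mulr1//.
  by apply/forall_inP => u; rewrite inE.
rewrite cond_probE -[X in X - _]W1 -sumrB.
apply: (@le_trans _ _ (\sum_Y \sum_q \sum_(k < Rr)
   \sum_(A : {set 'I_n} | (A \subset V q k.+1) && seeded A q k)
     W Y * (obeys A (V q k) Y)%:R)).
  apply: ler_sum => Y _; rewrite -/(W Y) -[X in X - _]mulr1 -mulrBr.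
  have rhs0 : 0 <= \sum_q \sum_(k < Rr)
      \sum_(A : {set 'I_n} | (A \subset V q k.+1) && seeded A q k)
      W Y * (obeys A (V q k) Y)%:R.
    by do 3!apply: sumr_ge0 => ? _; rewrite mulr_ge0.
  (* Selections of weight zero are set aside first: [bad_cover] needs picks that lie in their
     balls. *)
  have [W0|WY] := eqVneq (W Y) 0; first by rewrite {1}W0 mul0r.
  case: (leP ((1 - eps) * n%:R) (C1 (irr_edge Y))%:R) => bad; first by rewrite subrr mulr0.
  have [q [k [A [AV As Ao]]]] := bad_cover WY bad.
  rewrite subr0 mulr1 (bigD1 q)//= (bigD1 k)//= (bigD1 A)/=; last by rewrite AV.
  rewrite Ao mulr1 -!addrA lerDl !addr_ge0//; do ?by do ?apply: sumr_ge0 => ? _; rewrite mulr_ge0.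
rewrite exchange_big/=.
have -> : #|Q|%:R * Rr%:R * ((n.+1 ^ F * 2 ^ P Rr)%:R * expR (- (c * delta * mu / 4))) =
   \sum_(q : Q) \sum_(k < Rr) ((n.+1 ^ F * 2 ^ P Rr)%:R * expR (- (c * delta * mu / 4))).
  by rewrite !sumr_const card_ord -[RHS]mulr_natl -[X in _ = _ * X]mulr_natl -mulrA.
apply: ler_sum => q _; rewrite exchange_big/=; apply: ler_sum => k _.
rewrite exchange_big/=; exact: region_bound.
Qed.

End ConditionalBound.

(** * Cells and balls of the torus *)

(** Distance on the cycle of length [m]; with truncated subtraction, (i - j) + (j - i) is |i -
    j|. *)
Definition cyc (m i j : nat) : nat := minn ((i - j) + (j - i)) (m - ((i - j) + (j - i))).

(** The scaled difference of the points is within 1 of i - j, and y -> min (|y|, m - |y|) is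
    1-Lipschitz. *)
Lemma cyc_tcoord (R : realType) (m i j : nat) (a b : R) : (i < m)%N -> (j < m)%N ->
  i%:R <= m%:R * a <= i%:R + 1 -> j%:R <= m%:R * b <= j%:R + 1 ->
  (cyc m i j)%:R - 1 <= m%:R * tcoord (a - b) <= (cyc m i j)%:R + 1.
Proof.
move=> im jm /andP[a1 a2] /andP[b1 b2].
have m0 : 0 < m%:R :> R by rewrite ltr0n; apply: leq_ltn_trans im.
set d := ((i - j) + (j - i))%N.
have dm : (d <= m)%N by rewrite /d; lia.
have dE : d%:R = `|i%:R - j%:R| :> R.
  case: (leqP i j) => ij.
    rewrite ler0_norm ?subr_le0 ?ler_nat// opprB -natrB//; congr (_%:R); rewrite /d; lia.
  rewrite ger0_norm ?subr_ge0 ?ler_nat 1?ltnW// -natrB 1?ltnW//; congr (_%:R); rewrite /d; lia.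
have tE : m%:R * tcoord (a - b) = Num.min `|m%:R * a - m%:R * b| (m%:R - `|m%:R * a - m%:R * b|).
  by rewrite /tcoord -mulrBr normrM gtr0_norm// minr_pMr ?ltW// mulrBr mulr1.
have cE : (cyc m i j)%:R = Num.min `|i%:R - j%:R| (m%:R - `|i%:R - j%:R|) :> R.
  rewrite /cyc -/d -dE -natrB// /Num.min; case: ltP; rewrite ?ltr_nat ?ler_nat => h; congr (_%:R); lia.
rewrite tE cE; move: (m%:R * a) (m%:R * b) a1 a2 b1 b2 => w z a1 a2 b1 b2.
have h : `| `|w - z| - `|i%:R - j%:R| | <= 1.
  apply: le_trans (ler_dist_dist _ _) _; rewrite ler_norml; lra.
move: h; rewrite ler_norml => /andP[h1 h2].
rewrite /Num.min; case: ltP => h3; case: ltP => h4; lra.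
Qed.

Lemma tcoord_ge0 (R : realType) (a b : R) : 0 <= a <= 1 -> 0 <= b <= 1 ->
  0 <= tcoord (a - b).
Proof.
by move=> ha hb; rewrite /tcoord le_min normr_ge0 subr_ge0 ler_norml/=; lra.
Qed.

Lemma tdist_lt (R : realType) (z w : R * R) (r : R) : 0 < r ->
  (tdist z w < r) = (tcoord (z.1 - w.1) ^+ 2 + tcoord (z.2 - w.2) ^+ 2 < r ^+ 2).
Proof.
move=> r0; have {1}-> : r = Num.sqrt (r ^+ 2) by rewrite sqrtr_sqr gtr0_norm.
by rewrite /tdist ltr_sqrt// exprn_gt0.
Qed.

(** With [rho] the radius in units of the cell side, [touch] and [inside] are an outer and an inner
    approximation of the ball by cells. They use the extreme distances allowed by [cyc_tcoord],
    [.-1] staying at 0 for equal indices. *)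
Definition touch (R : realType) (m : nat) (rho : R) (c c' : 'I_m * 'I_m) : bool :=
  (((cyc m c.1 c'.1).-1 ^ 2 + (cyc m c.2 c'.2).-1 ^ 2)%N%:R < rho ^+ 2).

Definition inside (R : realType) (m : nat) (rho : R) (c c' : 'I_m * 'I_m) : bool :=
  (((cyc m c.1 c'.1).+1 ^ 2 + (cyc m c.2 c'.2).+1 ^ 2)%N%:R < rho ^+ 2).

Lemma card_le_target (T U : finType) (X : {set T}) (f : T -> U) :
  {in X &, injective f} -> (#|X| <= #|U|)%N.
Proof. by move=> /card_in_imset <-; exact: max_card. Qed.

(** The two comparisons select the sign of j - i and the branch of the minimum; on each of the four
    resulting pieces [cyc] is injective in j. *)
Lemma cyc_inj (m : nat) (i j j' : 'I_m) : (i <= j)%N = (i <= j')%N ->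
  ((i - j) + (j - i) <= m - ((i - j) + (j - i)))%N =
  ((i - j') + (j' - i) <= m - ((i - j') + (j' - i)))%N ->
  cyc m i j = cyc m i j' -> j = j'.
Proof.
move=> h1 h2 h3; apply: val_inj => /=; move: h1 h2 h3 (ltn_ord i) (ltn_ord j) (ltn_ord j').
by rewrite /cyc; lia.
Qed.

Lemma card_cyc_le (m w : nat) (i : 'I_m) : (#|[set j : 'I_m | (cyc m i j <= w)%N]| <= 4 * w.+1)%N.
Proof.
pose f (j : 'I_m) : bool * bool * 'I_w.+1 :=
  ((i <= j)%N, ((i - j) + (j - i) <= m - ((i - j) + (j - i)))%N, inord (cyc m i j)).
have := @card_le_target _ _ [set j : 'I_m | (cyc m i j <= w)%N] f.
rewrite !card_prod card_bool card_ord; apply=> j j'.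
rewrite !inE => hj hj' [] b1 b2 /(congr1 (@nat_of_ord _)); rewrite !inordK// => hc.
exact: cyc_inj b1 b2 hc.
Qed.

Lemma card_cyc_ge (m w : nat) (i : 'I_m) : (2 * w < m)%N ->
  (w.+1 <= #|[set j : 'I_m | (cyc m i j <= w)%N]|)%N.
Proof.
move=> wm; have m0 : (0 < m)%N by apply: leq_ltn_trans wm.
(* Walk [w] steps from [i] without wrapping: downwards if there is room, otherwise upwards, where i
   + w < 2 w < m. *)
pose f (k : 'I_w.+1) : 'I_m := insubd i (if (w <= i)%N then i - k else i + k)%N.
have fE (k : 'I_w.+1) : f k = (if (w <= i)%N then i - k else i + k)%N :> nat.
  rewrite /f val_insubd; case: ifP => // /negbT; case: ifP; have := ltn_ord i; have := ltn_ord k; lia.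
rewrite -[X in (X <= _)%N]card_ord -(@card_imset _ _ f); last first.
  move=> k k' /(congr1 (@nat_of_ord _)); rewrite !fE => h; apply: val_inj => /=.
  by move: h; have := ltn_ord k; have := ltn_ord k'; case: ifP; lia.
apply/subset_leq_card/fintype.subsetP => j /imsetP[k _ ->]; rewrite inE fE /cyc.
by have := ltn_ord k; case: ifP; lia.
Qed.

Lemma cyc_triangle (m : nat) (i j k : 'I_m) : (cyc m i k <= cyc m i j + cyc m j k)%N.
Proof. by rewrite /cyc; have := ltn_ord i; have := ltn_ord j; have := ltn_ord k; lia. Qed.

(* On a diagonal of cells the distance to [c] increases with each step, so at
   most two of its cells meet the ball without being contained in it. *)
Lemma card_touch_not_inside (R : realType) (m N : nat) (rho : R) (c : 'I_m * 'I_m) :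
  (0 < N)%N -> 0 <= rho <= N%:R ->
  (#|[set c' | touch rho c c' && ~~ inside rho c c']| <= 96 * N)%N.
Proof.
move=> N0 /andP[rho0 rhoN]; apply: (@leq_trans (32 * (2 * N).+1)); last by lia.
pose X := [set c' | touch rho c c' && ~~ inside rho c c'].
pose bit (i j : 'I_m) : bool * bool :=
  ((i <= j)%N, ((i - j) + (j - i) <= m - ((i - j) + (j - i)))%N).
(* Four bits for the pieces of [cyc_inj], the parity of the first distance, and the index of the
   diagonal, shifted by [N] to be nonnegative. Two different cells with equal codes would differ by
   at least 2 in both distances, which [key] forbids. *)
pose f (c' : 'I_m * 'I_m) : (bool * bool) * (bool * bool) * bool * 'I_(2 * N).+1 :=
  (bit c.1 c'.1, bit c.2 c'.2, odd (cyc m c.1 c'.1),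
   inord (cyc m c.1 c'.1 + N - cyc m c.2 c'.2)).
have bnd c' : c' \in X -> (cyc m c.1 c'.1 <= N)%N /\ (cyc m c.2 c'.2 <= N)%N.
  rewrite inE => /andP[h _]; have : (((cyc m c.1 c'.1).-1 ^ 2 + (cyc m c.2 c'.2).-1 ^ 2) < N ^ 2)%N.
    rewrite -(ltr_nat R) natrX; apply: lt_le_trans h _.
    by apply: lerXn2r; rewrite ?nnegrE.
  by move=> h2; split; nia.
have rng a b : (a <= N)%N -> (b <= N)%N -> (a + N - b < (2 * N).+1)%N by lia.
have diag a b a' b' : (a <= N)%N -> (b <= N)%N -> (a' <= N)%N -> (b' <= N)%N ->
    (a + N - b)%N = (a' + N - b')%N -> odd a = odd a' ->
    ~ ((a + 2 <= a')%N /\ (b + 2 <= b')%N) -> ~ ((a' + 2 <= a)%N /\ (b' + 2 <= b)%N) ->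
    a = a' /\ b = b' by lia.
have key a b a' b' : ((a'.-1 ^ 2 + b'.-1 ^ 2)%N%:R < rho ^+ 2) ->
    ~~ ((a.+1 ^ 2 + b.+1 ^ 2)%N%:R < rho ^+ 2) -> ~ ((a + 2 <= a')%N /\ (b + 2 <= b')%N).
  rewrite -leNgt => h1 h2 [h3 h4]; have := lt_le_trans h1 h2; rewrite ltr_nat; nia.
have := @card_le_target _ _ X f; rewrite !card_prod !card_bool card_ord.
apply=> c1 c2 Xc1 Xc2.
have [n11 n12] := bnd _ Xc1; have [n21 n22] := bnd _ Xc2.
move: Xc1 Xc2; rewrite !inE => /andP[t1 i1] /andP[t2 i2].
move=> [] b1 b2 b3 b4 ho /(congr1 (@nat_of_ord _)); rewrite !inordK ?rng// => hd.
have [e1 e2] := diag _ _ _ _ n11 n12 n21 n22 hd ho (key _ _ _ _ t2 i1) (key _ _ _ _ t1 i2).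
by case: c1 c2 b1 b2 b3 b4 e1 e2 {t1 t2 i1 i2 n11 n12 n21 n22 ho hd} => [? ?] [? ?] /= *; congr pair; apply: cyc_inj; eassumption.
Qed.

Lemma card_inside (R : realType) (m w : nat) (rho : R) (c : 'I_m * 'I_m) :
  (2 * w < m)%N -> (2 * w.+1 ^ 2)%N%:R < rho ^+ 2 ->
  (w.+1 ^ 2 <= #|[set c' | inside rho c c']|)%N.
Proof.
move=> wm hw.
apply: (@leq_trans #|finset.setX [set j : 'I_m | (cyc m c.1 j <= w)%N] [set j : 'I_m | (cyc m c.2 j <= w)%N]|).
  by rewrite cardsX -mulnn leq_mul ?card_cyc_ge.
apply/subset_leq_card/fintype.subsetP => -[i j]; rewrite !inE/= => /andP[h1 h2].
by apply: le_lt_trans hw; rewrite ler_nat mul2n -addnn leq_add// leq_exp2r.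
Qed.

(** The bound of [card_cyc_le] in both coordinates for a square block of half-width 5 k. *)
Definition ball_count (k : nat) : nat := ((4 * (5 * k).+1) ^ 2)%N.

Lemma cyc_succ (m k : nat) : (cyc m k.+1 k <= 1)%N /\ (cyc m k k.+1 <= 1)%N.
Proof. by rewrite /cyc; lia. Qed.

Lemma cyc_eq0 (m : nat) (i j : 'I_m) : (cyc m i j <= 0)%N = (j == i).
Proof.
rewrite -(inj_eq val_inj)/= /cyc; have := ltn_ord i; have := ltn_ord j; lia.
Qed.

(** * The coarse and the fine grid on the torus *)

Section Geometry.
Variables (R : realType) (n : nat) (s : seq (R * R)) (r : R) (M t m : nat).
Hypothesis size_s : size s = n.
Hypothesis s_square : all (@in_square R) s.
Hypothesis mE : m.+1 = (M.+1 * t.+1)%N.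
Hypothesis r0 : 0 < r.
Hypothesis r1 : r <= 1.
(** In units of the coarse side, points of adjacent cells differ by at most 2 in each coordinate and
    2 ^ 2 + 2 ^ 2 < 3 ^ 2, so they see each other. Points that see each other are less than 4 apart,
    so their cell indices differ by at most 5. *)
Hypothesis hr : 3 <= M.+1%:R * r <= 4.
Hypothesis mu4 : 4 <= n%:R / (M.+1 ^ 2)%:R :> R.
Hypothesis bal : balanced R n (map (@cell_of R m) s).

Let x (u : 'I_n) : R * R := nth (0, 0) s u.
Let nb := nbhd x r.
Let fc (u : 'I_n) : 'I_m.+1 * 'I_m.+1 := cell_of m (x u).
Let co (c : 'I_m.+1 * 'I_m.+1) : 'I_M.+1 * 'I_M.+1 :=
  (inord (c.1 %/ t.+1), inord (c.2 %/ t.+1)).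
Let cq u := co (fc u).
Let rho : R := m.+1%:R * r.
Let muf : R := n%:R / (m.+1 ^ 2)%:R.
Let mu : R := n%:R / (M.+1 ^ 2)%:R.
Let T := touch (m := m.+1) rho.
Let I := inside (m := m.+1) rho.
Let B (q : 'I_M.+1 * 'I_M.+1) (k : nat) : {set 'I_M.+1 * 'I_M.+1} :=
  [set q' : 'I_M.+1 * 'I_M.+1 | (cyc M.+1 q.1 q'.1 <= 5 * k)%N && (cyc M.+1 q.2 q'.2 <= 5 * k)%N].
Let adj (q q' : 'I_M.+1 * 'I_M.+1) : bool :=
  (cyc M.+1 q.1 q'.1 <= 1)%N && (cyc M.+1 q.2 q'.2 <= 1)%N.

Let xsq u : in_square (x u).
Proof. by apply: (allP s_square); rewrite mem_nth// size_s. Qed.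

Let rhoE : rho = t.+1%:R * (M.+1%:R * r).
Proof. by rewrite /rho mE natrM; ring. Qed.

Let rho_bounds : 3 * t.+1%:R <= rho <= (4 * t.+1)%N%:R.
Proof.
have /andP[h1 h2] := hr; rewrite rhoE natrM mulrC ler_wpM2l//=.
by rewrite [4 * _]mulrC ler_wpM2l.
Qed.

Let mu_muf : mu = (t.+1 ^ 2)%:R * muf.
Proof.
rewrite /mu /muf mE expnMn natrM; field.
by rewrite !nat1r !pnatr_eq0.
Qed.

Let coarse_ltn (i : 'I_m.+1) : (i %/ t.+1 < M.+1)%N.
Proof. by rewrite ltn_divLR// -mE. Qed.

Let fc_bounds u : [/\ (fc u).1%:R <= m.+1%:R * (x u).1 <= (fc u).1%:R + 1 &
  (fc u).2%:R <= m.+1%:R * (x u).2 <= (fc u).2%:R + 1].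
Proof. by have /andP[h1 h2] := xsq u; split; apply: cell_index_bounds. Qed.

Let coarse_bounds (i : 'I_m.+1) (a : R) : i%:R <= m.+1%:R * a <= i%:R + 1 ->
  (i %/ t.+1)%:R <= M.+1%:R * a <= (i %/ t.+1)%:R + 1.
Proof.
have t0 : 0 < t.+1%:R :> R by [].
have h1 : (i %/ t.+1 * t.+1 <= i)%N by exact: leq_trunc_div.
have h2 : (i.+1 <= (i %/ t.+1).+1 * t.+1)%N by exact: ltn_ceil.
have -> : m.+1%:R * a = M.+1%:R * a * t.+1%:R by rewrite mE natrM mulrAC.
move=> /andP[a1 a2]; apply/andP; split.
  rewrite -(ler_pM2r t0); by apply: le_trans a1; rewrite -natrM ler_nat.
rewrite -(ler_pM2r t0); apply: le_trans a2 _.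
by rewrite !natr1 -natrM ler_nat.
Qed.

Let cq_bounds u : [/\ (cq u).1%:R <= M.+1%:R * (x u).1 <= (cq u).1%:R + 1 &
  (cq u).2%:R <= M.+1%:R * (x u).2 <= (cq u).2%:R + 1].
Proof.
by have [h1 h2] := fc_bounds u; split; rewrite /cq/= inordK ?coarse_ltn//; exact: coarse_bounds.
Qed.

Let tc_ge0 u v : 0 <= tcoord ((x u).1 - (x v).1) /\ 0 <= tcoord ((x u).2 - (x v).2).
Proof.
have /andP[? ?] := xsq u; have /andP[? ?] := xsq v.
by split; apply: tcoord_ge0.
Qed.

Let nbE u v : (v \in nb u) =
  (tcoord ((x u).1 - (x v).1) ^+ 2 + tcoord ((x u).2 - (x v).2) ^+ 2 < r ^+ 2).
Proof. by rewrite inE tdist_lt. Qed.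

Let nb_scale (N : nat) u v : (v \in nb u) =
  ((N.+1%:R * tcoord ((x u).1 - (x v).1)) ^+ 2 + (N.+1%:R * tcoord ((x u).2 - (x v).2)) ^+ 2
    < (N.+1%:R * r) ^+ 2).
Proof. by rewrite nbE !exprMn -mulrDr ltr_pM2l// exprn_gt0. Qed.

Let nbT u v : v \in nb u -> T (fc u) (fc v).
Proof.
rewrite (nb_scale m); apply: le_lt_trans.
have [u1 u2] := fc_bounds u; have [v1 v2] := fc_bounds v.
have /andP[l1 _] := cyc_tcoord (ltn_ord _) (ltn_ord _) u1 v1.
have /andP[l2 _] := cyc_tcoord (ltn_ord _) (ltn_ord _) u2 v2.
have [g1 g2] := tc_ge0 u v.
have pr (a : nat) (z : R) : 0 <= z -> a%:R - 1 <= m.+1%:R * z ->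
    (a.-1 ^ 2)%:R <= (m.+1%:R * z) ^+ 2.
  move=> z0 az; rewrite natrX; apply: lerXn2r; rewrite ?nnegrE ?mulr_ge0//.
  case: a az => [|a] az; first by rewrite mulr_ge0.
  by apply: le_trans az; rewrite -natr1 addrK.
by rewrite natrD lerD// pr.
Qed.

Let Inb u v : I (fc u) (fc v) -> v \in nb u.
Proof.
rewrite (nb_scale m); apply: le_lt_trans.
have [u1 u2] := fc_bounds u; have [v1 v2] := fc_bounds v.
have /andP[_ l1] := cyc_tcoord (ltn_ord _) (ltn_ord _) u1 v1.
have /andP[_ l2] := cyc_tcoord (ltn_ord _) (ltn_ord _) u2 v2.
have [g1 g2] := tc_ge0 u v.
have pr (a : nat) (z : R) : 0 <= z -> m.+1%:R * z <= a%:R + 1 ->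
    (m.+1%:R * z) ^+ 2 <= (a.+1 ^ 2)%:R.
  move=> z0 az; rewrite natrX; apply: lerXn2r; rewrite ?nnegrE ?mulr_ge0//.
  by rewrite -[a.+1%:R]natr1.
by rewrite natrD lerD// pr.
Qed.

Let Bnb q k u v : cq u \in B q k -> v \in nb u -> cq v \in B q k.+1.
Proof.
move=> + vu; rewrite !inE => /andP[h1 h2].
suff [e1 e2] : (cyc M.+1 (cq u).1 (cq v).1 <= 5)%N /\ (cyc M.+1 (cq u).2 (cq v).2 <= 5)%N.
  rewrite mulnS addnC; apply/andP; split;
    by apply: leq_trans (cyc_triangle _ _ _) _; apply: leq_add; eassumption.
move: vu; rewrite (nb_scale M) => vu.
have [u1 u2] := cq_bounds u; have [v1 v2] := cq_bounds v.
have /andP[l1 _] := cyc_tcoord (ltn_ord _) (ltn_ord _) u1 v1.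
have /andP[l2 _] := cyc_tcoord (ltn_ord _) (ltn_ord _) u2 v2.
have /andP[_ hr4] := hr.
have small (z w : R) : z ^+ 2 + w ^+ 2 < (M.+1%:R * r) ^+ 2 -> z <= 4.
  move=> zw; rewrite leNgt; apply/negP => z4.
  have : (M.+1%:R * r) ^+ 2 <= 4 ^+ 2 by apply: lerXn2r => //; rewrite nnegrE// mulr_ge0// ltW.
  have : 4 ^+ 2 <= z ^+ 2 by apply: lerXn2r; rewrite ?nnegrE//; lra.
  by have := sqr_ge0 w; lra.
have s1 := small _ _ vu; have s2 : M.+1%:R * tcoord ((x u).2 - (x v).2) <= 4.
  by apply: small; rewrite addrC; exact: vu.
by split; rewrite -(ler_nat R); lra.
Qed.

Let adj_nb u v : adj (cq u) (cq v) -> v \in nb u.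
Proof.
move=> /andP[h1 h2]; rewrite (nb_scale M).
have [u1 u2] := cq_bounds u; have [v1 v2] := cq_bounds v.
have /andP[_ l1] := cyc_tcoord (ltn_ord _) (ltn_ord _) u1 v1.
have /andP[_ l2] := cyc_tcoord (ltn_ord _) (ltn_ord _) u2 v2.
have [g1 g2] := tc_ge0 u v.
have /andP[hr3 _] := hr.
have pr (a : nat) (z : R) : 0 <= z -> (a <= 1)%N -> M.+1%:R * z <= a%:R + 1 ->
    (M.+1%:R * z) ^+ 2 <= 2 ^+ 2.
  move=> z0 a1 az; apply: lerXn2r; rewrite ?nnegrE ?mulr_ge0//.
  by move: a1; rewrite -(ler_nat R); lra.
have := pr _ _ g1 h1 l1; have := pr _ _ g2 h2 l2.
have : 3 ^+ 2 <= (M.+1%:R * r) ^+ 2 by apply: lerXn2r; rewrite ?nnegrE//; lra.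
lra.
Qed.

Let B0 q : B q 0 = [set q]%SET.
Proof.
apply/setP => q'; rewrite !inE muln0 !cyc_eq0; case: q q' => [i j] [i' j'].
by rewrite xpair_eqE.
Qed.

Let Bmono q k : B q k \subset B q k.+1.
Proof.
apply/fintype.subsetP => q'; rewrite !inE => /andP[h1 h2].
have h : (5 * k <= 5 * k.+1)%N by rewrite leq_mul2l leqnSn.
by rewrite (leq_trans h1 h) (leq_trans h2 h).
Qed.

Let adjxx q : adj q q.
Proof. by rewrite /adj /cyc !subnn. Qed.

Let line_conn (f : 'I_M.+1 -> bool) :
  (forall i j : 'I_M.+1, (cyc M.+1 i j <= 1)%N -> f i -> f j) -> forall i j, f i -> f j.
Proof.
move=> fstep.
have step k : (k < M.+1)%N -> f (inord k) = f ord0.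
  elim: k => [_|k IHk kM]; first by congr f; apply: val_inj; rewrite /= inordK.
  rewrite -(IHk (ltnW kM)); have [c1 c2] := cyc_succ M.+1 k.
  by apply/idP/idP; apply: fstep; rewrite !inordK// ltnW.
move=> i j; have := step _ (ltn_ord i); have := step _ (ltn_ord j).
by rewrite !inord_val => -> ->.
Qed.

Let adj_conn (S : {set 'I_M.+1 * 'I_M.+1}) :
  (forall q q', adj q q' -> q \in S -> q' \in S) -> forall q q', q \in S -> q' \in S.
Proof.
move=> Sadj [i j] [i' j'] qS.
have cc a : cyc M.+1 a a = 0%N by rewrite /cyc subnn min0n.
have : (i', j) \in S.
  apply: (line_conn (f := fun a => (a, j) \in S)) qS => a b ab; apply: Sadj.
  by rewrite /adj/= ab cc.
apply: (line_conn (f := fun a => (i', a) \in S)) => a b ab; apply: Sadj.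
by rewrite /adj/= ab cc.
Qed.

Let fine_count c : muf / 2 <= #|[set u | fc u == c]|%:R /\ #|[set u | fc u == c]|%:R <= 2 * muf.
Proof.
have -> : #|[set u | fc u == c]| = count_mem c (map (@cell_of R m) s).
  rewrite count_map -size_filter.
  rewrite -sum1_card; under eq_bigl do rewrite inE.
  rewrite -sum1_size big_filter (big_nth (0, 0)) size_s big_mkord.
  by apply: eq_bigl => u.
by move/forallP/(_ c)/andP: bal; rewrite card_prod !card_ord mulnn -/muf.
Qed.

Let card_fiber (D : {set 'I_M.+1 * 'I_M.+1}) : #|[set c : 'I_m.+1 * 'I_m.+1 | co c \in D]| = (t.+1 ^ 2 * #|D|)%N.
Proof.
have one (i : 'I_M.+1) : #|[set a : 'I_m.+1 | inord (a %/ t.+1) == i]| = t.+1.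
  have lt (k : 'I_t.+1) : (i * t.+1 + k < m.+1)%N.
    by rewrite mE; apply: (@leq_trans (i.+1 * t.+1)); [rewrite mulSn addnC ltn_add2r|rewrite leq_mul2r ltn_ord orbT].
  rewrite -[RHS]card_ord -(@card_imset _ _ (fun k : 'I_t.+1 => Ordinal (lt k))); last first.
    by move=> k k' /(congr1 (@nat_of_ord _)) /= /addnI; exact: val_inj.
  apply: eq_card => a; rewrite inE; apply/eqP/imsetP => [ai|[k _ ->]].
    have ia : (a %/ t.+1 = i)%N by rewrite -ai inordK// coarse_ltn.
    exists (Ordinal (ltn_pmod a (ltn0Sn t))) => //.
    by apply: val_inj; rewrite /= -ia -divn_eq.
  by apply: val_inj; rewrite /= divnMDl// divn_small// addn0 inord_val.
rewrite -sum1_card (partition_big co (mem D))/=; last by move=> c; rewrite inE.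
rewrite (eq_bigr (fun=> (t.+1 ^ 2)%N)); first by rewrite sum_nat_const mulnC.
move=> [i j] ijD; rewrite sum1_card -mulnn -[in X in (X * _)%N](one i) -[in X in (_ * X)%N](one j) -cardsX.
apply: eq_card => -[a b]; rewrite !inE unfold_in/= inE.
rewrite -[co (a, b) == (i, j)]/((inord (a %/ t.+1) == i) && (inord (b %/ t.+1) == j)).
case: eqP => ai; case: eqP => bj; rewrite ?andbF//= andbT.
by rewrite /co/= ai bj.
Qed.

Let sum_fine (D : {pred 'I_m.+1 * 'I_m.+1}) :
  #|[set u | fc u \in D]| = (\sum_(c in D) #|[set u | fc u == c]|)%N.
Proof.
rewrite -sum1_card (partition_big fc (mem D))/=; last by move=> u; rewrite inE.
apply: eq_bigr => c cD; rewrite -sum1_card; apply: eq_bigl => u; rewrite !inE.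
by case: eqP => [->|]; rewrite ?andbF ?andbT.
Qed.

Let muf_ge0 : 0 <= muf. Proof. by rewrite divr_ge0. Qed.

Let sum_fine_le (D : {pred 'I_m.+1 * 'I_m.+1}) :
  #|[set u | fc u \in D]|%:R <= #|D|%:R * (2 * muf).
Proof.
rewrite sum_fine natr_sum mulr_natl -sumr_const.
by apply: ler_sum => c _; case: (fine_count c).
Qed.

Let sum_fine_ge (D : {pred 'I_m.+1 * 'I_m.+1}) :
  #|D|%:R * (muf / 2) <= #|[set u | fc u \in D]|%:R.
Proof.
rewrite sum_fine natr_sum mulr_natl -sumr_const.
by apply: ler_sum => c _; case: (fine_count c).
Qed.

(** Balance is assumed for the fine cells; a coarse cell is a union of [t.+1 ^ 2] of them and
    inherits the same factors. *)
Let coarse_count q : mu / 2 <= #|[set u | cq u == q]|%:R /\ #|[set u | cq u == q]|%:R <= 2 * mu.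
Proof.
have -> : [set u | cq u == q] = [set u | fc u \in [set c : 'I_m.+1 * 'I_m.+1 | co c \in [set q]%SET]].
  by apply/setP => u; rewrite !inE.
have := sum_fine_le (mem [set c : 'I_m.+1 * 'I_m.+1 | co c \in [set q]%SET]).
have := sum_fine_ge (mem [set c : 'I_m.+1 * 'I_m.+1 | co c \in [set q]%SET]).
rewrite card_fiber cards1 muln1 mu_muf => h1 h2; split; first by rewrite -mulrA.
by rewrite mulrCA.
Qed.

Let card_B q k : (#|B q k| <= ball_count k)%N.
Proof.
have -> : B q k = finset.setX [set j : 'I_M.+1 | (cyc M.+1 q.1 j <= 5 * k)%N]
    [set j : 'I_M.+1 | (cyc M.+1 q.2 j <= 5 * k)%N].
  by apply/setP => -[i j]; rewrite !inE.
by rewrite cardsX /ball_count -mulnn leq_mul// card_cyc_le.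
Qed.

Let mu_gt0 : 0 < mu. Proof. by apply: lt_le_trans mu4. Qed.

(* 1152 = 2 * ball_count 1 *)
Let nbhi u : #|nb u|%:R <= 1152 * mu.
Proof.
have h : #|nb u|%:R <= 2 * mu * (ball_count 1)%:R.
  apply: le_trans (@card_block R n _ cq B mu ball_count mu_gt0 (fun q => (coarse_count q).2) card_B (cq u) 1).
  rewrite ler_nat; apply/subset_leq_card/fintype.subsetP => v vu; rewrite inE.
  by apply: (@Bnb _ 0 u) => //; rewrite B0 set11.
by apply: le_trans h _; rewrite (_ : ball_count 1 = 576)%N//; lra.
Qed.

Let nb2 u : (1 < #|nb u|)%N.
Proof.
have h : (#|[set v | cq v == cq u]| <= #|nb u|)%N.
  apply/subset_leq_card/fintype.subsetP => v; rewrite inE => /eqP vu.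
  by apply: adj_nb; rewrite vu adjxx.
apply: leq_trans h; rewrite -(ler_nat R); have := (coarse_count (cq u)).1.
by apply: le_trans; have := mu4; rewrite -/mu; lra.
Qed.

(* The ball contains at least [t.+1 ^ 2] whole cells, with [muf / 2] points each,
   and at most [96 * (4 * t.+1)] cells, with [2 * muf] points each, cross its
   boundary. *)
Let nbcard u : #|[set v | T (fc u) (fc v)]|%:R <= (1 + 1536 / t.+1%:R) * #|nb u|%:R :> R.
Proof.
have t0 : 0 < t.+1%:R :> R by [].
have t1 : 1 <= t.+1%:R :> R by rewrite ler1n.
have /andP[rho3 rho4] := rho_bounds.
have inl : (t.+1 ^ 2 <= #|[set c' | I (fc u) c']|)%N.
  apply: card_inside.
    (* From r <= 1; the square of cells of half-width [t] then does not wrap around the torus. *)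
    have M3 : (3 <= M.+1)%N.
      have /andP[h3 _] := hr; rewrite -(ler_nat R); apply: le_trans h3 _.
      by rewrite ler_piMr.
    rewrite mE; apply: (@leq_trans (3 * t.+1)%N); last by rewrite leq_mul2r M3 orbT.
    by rewrite ltn_mul//.
  rewrite natrM natrX.
  have rhop : 0 <= rho by lra.
  have : (3 * t.+1%:R) ^+ 2 <= rho ^+ 2 by apply: lerXn2r; rewrite // nnegrE mulr_ge0.
  have : 0 < t.+1%:R ^+ 2 :> R by rewrite exprn_gt0.
  by rewrite exprMn; lra.
have out : (#|[set c' | T (fc u) c' && ~~ I (fc u) c']| <= 96 * (4 * t.+1))%N.
  by apply: card_touch_not_inside => //; rewrite rho4 andbT; lra.
have cin := sum_fine_ge (mem [set c' | I (fc u) c']).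
have cout := sum_fine_le (mem [set c' | T (fc u) c' && ~~ I (fc u) c']).
have cnb : #|[set v | fc v \in [set c' | I (fc u) c']]|%:R <= #|nb u|%:R :> R.
  rewrite ler_nat; apply/subset_leq_card/fintype.subsetP => v; rewrite inE [_ \in [set c' | _]]inE.
  exact: Inb.
have ctot : #|[set v | T (fc u) (fc v)]|%:R <=
    #|nb u|%:R + #|[set v | fc v \in [set c' | T (fc u) c' && ~~ I (fc u) c']]|%:R :> R.
  rewrite -natrD ler_nat; apply: leq_trans (leq_card_setU _ _).
  apply/subset_leq_card/fintype.subsetP => v; rewrite inE => Tv; rewrite finset.in_setU.
  case: (boolP (I (fc u) (fc v))) => Iv; first by rewrite Inb.
  by apply/orP; right; rewrite !inE Tv.
have nblow : t.+1%:R ^+ 2 * (muf / 2) <= #|nb u|%:R.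
  apply: le_trans cnb; apply: le_trans cin; rewrite -natrX ler_wpM2r ?divr_ge0// ler_nat.
  exact: inl.
have outup : #|[set v | fc v \in [set c' | T (fc u) c' && ~~ I (fc u) c']]|%:R <=
    384 * t.+1%:R * (2 * muf).
  apply: le_trans cout _; rewrite ler_wpM2r ?mulr_ge0//.
  apply: (@le_trans _ _ (96 * (4 * t.+1))%N%:R); first by rewrite ler_nat; exact: out.
  by rewrite -natrM ler_nat mulnA.
apply: le_trans ctot _; rewrite mulrDl mul1r lerD2l; apply: le_trans outup _.
(* 1536 = 4 * 384, the 4 being the ratio of 2 muf to muf / 2. *)
apply: (@le_trans _ _ (1536 / t.+1%:R * (t.+1%:R ^+ 2 * (muf / 2)))).
  by rewrite le_eqVlt; apply/orP; left; apply/eqP; field; rewrite gt_eqF.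
apply: ler_wpM2l nblow.
exact: (divr_ge0 (ler0n _ _) (ler0n _ _)).
Qed.

Let ball_count_mono (k k' : nat) : (k <= k')%N -> (ball_count k <= ball_count k')%N.
Proof. by move=> kk; rewrite /ball_count leq_exp2r// leq_mul2l ltnS leq_mul2l kk. Qed.

Lemma cond_prob_balanced (K : nat) (p : nat -> R) (eps L : R) (Rr : nat)
    (delta := eps / (96 * 1152)) :
  (1 < K)%N -> (forall k, 0 <= p k) -> p 0 = 0 -> \sum_(j < K.+1) p j = 1 ->
  p 1 < 1 -> 0 < eps < 1 -> 0 < L ->
  2 * (ball_count Rr)%:R < (1 + (1 - p 1) / (4 * 1152 * L)) ^+ Rr * delta ->
  2 * (ball_count Rr)%:R * (1536 / t.+1%:R + expR (- L)) <= (1 - p 1) * delta / 4 ->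
  1 - cond_prob x r K p eps <=
  (M.+1 ^ 2)%:R * Rr%:R * ((n.+1 ^ (t.+1 ^ 2 * ball_count Rr) * 2 ^ ball_count Rr)%:R *
    expR (- ((1 - p 1) * delta * mu / 4))).
Proof.
move=> K1 p0 p00 psum p11 eps01 L0 hR hL.
have Qn : #|{: 'I_M.+1 * 'I_M.+1}|%:R * mu = n%:R.
  by rewrite card_prod card_ord mulnn /mu mulrC divfK// pnatr_eq0.
(* The number of fine cells in a block does not depend on [n], so the profiles are polynomially
   many. *)
have cfcard q k : (k <= Rr)%N -> (#|fc @: block cq B q k| <= t.+1 ^ 2 * ball_count Rr)%N.
  move=> kR; apply: (@leq_trans #|[set c : 'I_m.+1 * 'I_m.+1 | co c \in B q k]|).
    apply/subset_leq_card/fintype.subsetP => c /imsetP[u uB ->].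
    rewrite finset.in_set; move: uB; rewrite finset.in_set; exact: id.
  rewrite card_fiber leq_mul2l; apply/orP; right.
  exact: leq_trans (card_B q k) (ball_count_mono kR).
have -> : (M.+1 ^ 2)%:R = #|{: 'I_M.+1 * 'I_M.+1}|%:R :> R.
  by rewrite card_prod card_ord mulnn.
have [K0 K0E] : exists K0 : R, K0 = 1152 by exists 1152.
have [eta etaE] : exists eta : R, eta = 1536 / t.+1%:R by eexists.
have K00 : 0 < K0 by rewrite K0E ltr0n.
have eta0 : 0 <= eta by rewrite etaE; exact: (divr_ge0 (ler0n _ _) (ler0n _ _)).
have nbhi' u : #|nb u|%:R <= K0 * mu by rewrite K0E nbhi.
have nbcard' u : #|[set v | T (fc u) (fc v)]|%:R <= (1 + eta) * #|nb u|%:R :> R.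
  by rewrite etaE nbcard.
have deltaE : delta = eps / (96 * K0) by rewrite K0E.
move: hR hL; rewrite -K0E -etaE => hR hL.
apply: (@cond_prob_lower R n x r K p eps _ cq B adj mu K0 ball_count _ fc T _ Rr
  eta L delta K1 p0 p00 psum _ eps01 mu_gt0 K00 B0 Bmono (@Bnb) adjxx adj_nb adj_conn
  (fun q => (coarse_count q).1) (fun q => (coarse_count q).2) nbhi' card_B
  (fun k kR => ball_count_mono kR) Qn L0 eta0 nbT nbcard' nb2 cfcard deltaE hR hL).
by rewrite subr_gt0.
Qed.

End Geometry.

(** * Choice of the scales and conclusion *)

Lemma cond_prob_bounds (R : realType) (n : nat) (x : 'I_n -> R * R) (r : R)
    (K : nat) (p : nat -> R) (eps : R) : (forall k, 0 <= p k) ->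
  \sum_(j < K.+1) p j = 1 -> 0 <= cond_prob x r K p eps <= 1.
Proof.
move=> p0 psum; rewrite cond_probE.
have W0 Y : 0 <= \prod_u pick_weight x r K p u (Y u).
  by apply: prodr_ge0 => u _; exact: pick_weight_ge0.
have W1 : \sum_(Y : {ffun 'I_n -> {set 'I_n}}) \prod_u pick_weight x r K p u (Y u) = 1.
  rewrite -(bigA_distr_bigA (fun u S => pick_weight x r K p u S)) big1// => u _.
  exact: sum_pick_weight.
apply/andP; split; first by apply: sumr_ge0 => Y _; rewrite mulr_ge0.
rewrite -[leRHS]W1; apply: ler_sum => Y _; rewrite -[leRHS]mulr1 ler_wpM2l//.
by rewrite lern1 leq_b1.
Qed.

Lemma cond_prob_eq_nbhd (R : realType) (n : nat) (x : 'I_n -> R * R) (r r' : R)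
    (K : nat) (p : nat -> R) (eps : R) : (forall u, nbhd x r u = nbhd x r' u) ->
  cond_prob x r K p eps = cond_prob x r' K p eps.
Proof.
move=> h; rewrite !cond_probE; apply: eq_bigr => Y _; congr (_ * _).
by apply: eq_bigr => u _; rewrite /pick_weight /rho h.
Qed.

(** Each coordinate distance is at most 1/2. Hence radii above 1 act like the radius 1, and the
    grids are only needed for r <= 1. *)
Lemma tdist_lt1 (R : realType) (z w : R * R) : in_square z -> in_square w -> tdist z w < 1.
Proof.
move=> /andP[z1 z2] /andP[w1 w2]; rewrite tdist_lt// expr1n.
have tb (a b : R) : 0 <= a <= 1 -> 0 <= b <= 1 -> tcoord (a - b) ^+ 2 <= 4^-1.
  move=> ha hb; have t0 := tcoord_ge0 ha hb.
  have t2 : tcoord (a - b) <= 2^-1 by rewrite /tcoord ge_min; case: (lerP `|a - b| 2^-1) => h //=; lra.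
  apply: (@le_trans _ _ (2^-1 ^+ 2)); first by apply: lerXn2r; rewrite ?nnegrE// invr_ge0.
  by rewrite exprVn lef_pV2 ?posrE//; rewrite -natrX ler_nat.
have := tb _ _ z1 w1; have := tb _ _ z2 w2; lra.
Qed.

Lemma nbhd_min1 (R : realType) (n : nat) (x : 'I_n -> R * R) (r : R) (u : 'I_n) :
  (forall v, in_square (x v)) -> nbhd x r u = nbhd x (Num.min r 1) u.
Proof.
by move=> hx; apply/setP => v; rewrite !inE lt_min tdist_lt1// andbT.
Qed.

Lemma prob_giant_ge (R : realType) (K : nat) (p : nat -> R) (n m : nat) (r eps b : R) :
  (forall k, 0 <= p k) -> \sum_(j < K.+1) p j = 1 -> 0 <= b ->
  (forall s, size s = n -> all (@in_square R) s ->
    balanced R n (map (@cell_of R m) s) ->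
    1 - cond_prob (fun i : 'I_n => nth (0, 0) s i) r K p eps <= b) ->
  1 - b - 2 * (m.+1 ^ 2)%:R * expR (- (n%:R / (m.+1 ^ 2)%:R / 20)) <= prob_giant K p n r eps <= 1.
Proof.
move=> p0 psum b0 hb.
(* Truncated at 0 to keep the minorant [H] nonnegative; [H] is constant on cells, so its integral is
   a finite average. *)
pose B : R := Num.max 0 (1 - b).
have B0 : 0 <= B by rewrite le_max lexx.
have B1 : B <= 1 by rewrite ge_max ler01/=; lra.
pose H (cs : seq ('I_m.+1 * 'I_m.+1)) : R := B * (balanced R n cs)%:R.
have H0 cs : 0 <= H cs by rewrite mulr_ge0.
have Hle s : size s = n -> all (@in_square R) s -> H (map (@cell_of R m) s) <=
    cond_prob (fun i : 'I_n => nth (0, 0) s i) r K p eps.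
  move=> hs hsq; have /andP[c0 c1] := cond_prob_bounds (fun i : 'I_n => nth (0, 0) s i) r eps p0 psum.
  rewrite /H; case: (boolP (balanced R n _)) => bal; last by rewrite mulr0.
  rewrite mulr1 /B ge_max c0/=; have := hb s hs hsq bal; lra.
have [_ h1 h2] := @iter_int_mono R n (fun s => H (map (@cell_of R m) s))
  (fun s => cond_prob (fun i : 'I_n => nth (0, 0) s i) r K p eps)
  (fun s _ _ => H0 _) Hle
  (fun s _ _ => proj2 (andP (cond_prob_bounds _ r eps p0 psum))).
rewrite /prob_giant h2 andbT; apply: le_trans h1.
rewrite (iter_int_cells _ H0) /H iter_avgZ.
have C0 : (0 < #|{: 'I_m.+1 * 'I_m.+1}|)%N by rewrite card_prod card_ord.
have := @iter_avg_balanced R _ n C0; rewrite card_prod card_ord mulnn.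
set e := 2 * _ * _; set a := iter_avg _ _ => ea.
have e0 : 0 <= e by rewrite !mulr_ge0// expR_ge0.
apply: (@le_trans _ _ (B * (1 - e))); last by rewrite ler_wpM2l.
have bB : 1 - b <= B by rewrite le_max lexx orbT.
have : B * e <= e by rewrite ler_piMl.
lra.
Qed.

(** From exp y >= 1 + y ^ 5 / 5!, once l + 1 > 120 C / w ^ 5. *)
Lemma exp_beats_quartic (R : realType) (w C : R) : 0 < w -> 0 < C ->
  exists N : nat, forall l, (N <= l)%N -> C * l.+1%:R ^+ 4 < expR (l.+1%:R * w).
Proof.
move=> w0 C0; have w5 : 0 < w ^+ 5 by rewrite exprn_gt0.
exists (Num.trunc (C * 120 / w ^+ 5)).+1 => l Nl.
have l0 : 0 < l.+1%:R :> R by [].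
have hl : C * 120 / w ^+ 5 < l.+1%:R.
  apply: lt_le_trans (truncnS_gt _) _; rewrite ler_nat; exact: (leqW Nl).
have := @expR_ge1Dxn R (l.+1%:R * w) 4 (mulr_ge0 (ltW l0) (ltW w0)).
apply: lt_le_trans; rewrite (_ : 5`! = 120)%N// exprMn.
move: hl; rewrite ltr_pdivrMr// => hl.
apply: (@lt_trans _ _ (l.+1%:R ^+ 5 * w ^+ 5 / 120)); last by rewrite ltrDr.
rewrite ltr_pdivlMr//; move: hl; rewrite -(ltr_pM2r (exprn_gt0 4 l0)).
have -> : C * 120 * l.+1%:R ^+ 4 = C * l.+1%:R ^+ 4 * 120 by ring.
by have -> : l.+1%:R * w ^+ 5 * l.+1%:R ^+ 4 = l.+1%:R ^+ 5 * w ^+ 5 by ring.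
Qed.

Lemma bernoulli (R : realType) (y : R) (k : nat) : 0 <= y -> 1 + k%:R * y <= (1 + y) ^+ k.
Proof.
move=> y0; elim: k => [|k IHk]; first by rewrite mul0r addr0.
rewrite exprS; apply: (@le_trans _ _ ((1 + y) * (1 + k%:R * y))).
  have : 0 <= k%:R * y ^+ 2 by rewrite mulr_ge0// exprn_ge0.
  rewrite -natr1; lra.
by rewrite ler_wpM2l// addr_ge0.
Qed.

Lemma ball_count_quartic : exists2 A : nat, (0 < A)%N &
  forall l, (ball_count (l.+1 * l.+1) <= A * l.+1 ^ 4)%N.
Proof.
(* 4 (5 k + 1) <= 24 k for k >= 1. *)
exists (24 ^ 2)%N => // l.
rewrite /ball_count (_ : 4 = 2 * 2)%N// [in leqRHS]expnM -expnMn leq_exp2r//.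
rewrite -mulnn; have : (0 < l.+1 * l.+1)%N by []; move: (l.+1 * l.+1)%N => k; lia.
Qed.

(** Take [Rr] = L ^ 2. By Bernoulli (1 + z / L) ^ (L ^ 2) >= (1 + z) ^ L, which is exponential in L,
    while the block count is of order L ^ 4; the same comparison makes the exp (- L) term small. The
    fine scale [t] comes last, with L already fixed. *)
Lemma exists_scales (R : realType) (c K0 E delta : R) : 0 < c -> 0 < K0 -> 0 < E -> 0 < delta ->
  exists (L : R) (Rr t : nat), [/\ 0 < L,
   2 * (ball_count Rr)%:R < (1 + c / (4 * K0 * L)) ^+ Rr * delta &
   2 * (ball_count Rr)%:R * (E / t.+1%:R + expR (- L)) <= c * delta / 4].
Proof.
move=> c0 K00 E0 d0.
have [A A0 hA] := ball_count_quartic.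
have A0R : 0 < A%:R :> R by rewrite ltr0n.
pose z := c / (4 * K0); have z0 : 0 < z by rewrite divr_gt0 ?mulr_gt0.
pose w := ln (1 + z); have w0 : 0 < w by rewrite ln_gt0// ltrDl.
have [N1 h1] := @exp_beats_quartic R w (2 * A%:R / delta) w0 ltac:(by rewrite divr_gt0// mulr_gt0).
have [N2 h2] := @exp_beats_quartic R 1 (16 * A%:R / (c * delta)) ltr01
  ltac:(by rewrite divr_gt0 ?mulr_gt0).
pose l := maxn N1 N2.
have := h1 l (leq_maxl _ _); have := h2 l (leq_maxr _ _); rewrite mulr1 => {h1 h2} h2 h1.
pose L : R := l.+1%:R; have L0 : 0 < L by [].
have bc : (ball_count (l.+1 * l.+1))%:R <= A%:R * L ^+ 4.
  by rewrite /L -natrX -natrM ler_nat hA.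
set bcR : R := (ball_count _)%:R in bc *.
have bc0 : 0 <= bcR by [].
exists L, (l.+1 * l.+1)%N, (Num.trunc (2 * bcR * E * 8 / (c * delta))); rewrite -/bcR.
have cd0 : 0 < c * delta by rewrite mulr_gt0.
split=> //.
  apply: (@lt_le_trans _ _ ((1 + z) ^+ l.+1 * delta)).
    have -> : (1 + z) ^+ l.+1 = expR (l.+1%:R * w).
      by rewrite expRM_natl lnK// posrE addr_gt0.
    move: h1; rewrite -/L mulrAC ltr_pdivrMr//; lra.
  have zL0 : 0 <= z / L by rewrite divr_ge0 ?ltW.
  have base : 1 + z <= (1 + z / L) ^+ l.+1.
    by apply: le_trans (bernoulli l.+1 zL0); rewrite -/L mulrCA divff ?mulr1// gt_eqF.
  rewrite ler_pM2r// (_ : c / (4 * K0 * L) = z / L); last by rewrite /z; field; rewrite !gt_eqF.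
  rewrite exprM; apply: lerXn2r base; rewrite nnegrE; [by rewrite addr_ge0// ltW|by rewrite exprn_ge0// addr_ge0].
rewrite mulrDr.
have e1 : 2 * bcR * (E / (Num.trunc (2 * bcR * E * 8 / (c * delta))).+1%:R) <= c * delta / 8.
  have := truncnS_gt (2 * bcR * E * 8 / (c * delta)); set T := _.+1%:R => hT.
  have T0 : 0 < T by rewrite ltr0n.
  rewrite mulrA ler_pdivrMr// ; move: hT; rewrite ltr_pdivrMr//; lra.
have e2 : 2 * bcR * expR (- L) <= c * delta / 8.
  rewrite expRN ler_pdivrMr ?expR_gt0//.
  move: h2; rewrite -/L mulrAC ltr_pdivrMr// => h2.
  lra.
by apply: le_trans (lerD e1 e2) _; lra.
Qed.

Lemma cond_prob_estimate (R : realType) (K : nat) (p : nat -> R) (eps : R) :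
  (1 < K)%N -> (forall k, 0 <= p k) -> p 0 = 0 -> \sum_(j < K.+1) p j = 1 ->
  p 1 < 1 -> 0 < eps < 1 ->
  exists (a : R) (Rr t N1 N2 : nat), 0 < a /\
    forall (n : nat) (s : seq (R * R)) (r : R) (M m : nat),
    size s = n -> all (@in_square R) s -> m.+1 = (M.+1 * t.+1)%N ->
    0 < r -> r <= 1 -> 3 <= M.+1%:R * r <= 4 -> 4 <= n%:R / (M.+1 ^ 2)%:R :> R ->
    balanced R n (map (@cell_of R m) s) ->
    1 - cond_prob (fun u : 'I_n => nth (0, 0) s u) r K p eps <=
    (M.+1 ^ 2)%:R * Rr%:R * ((n.+1 ^ N1 * 2 ^ N2)%:R *
      expR (- (a * (n%:R / (M.+1 ^ 2)%:R)))).
Proof.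
move=> K1 p0 p00 psum p11 eps01.
pose q := 1 - p 1; have q0 : 0 < q by rewrite subr_gt0.
pose delta : R := eps / (96 * 1152).
have delta0 : 0 < delta.
  by rewrite divr_gt0 ?mulr_gt0 ?ltr0n//; case/andP: eps01.
have K00 : 0 < 1152 :> R by rewrite ltr0n.
have E0 : 0 < 1536 :> R by rewrite ltr0n.
have [L [Rr [t [L0 hR hL]]]] := exists_scales q0 K00 E0 delta0.
exists (q * delta / 4), Rr, t, (t.+1 ^ 2 * ball_count Rr)%N, (ball_count Rr); split.
  by rewrite divr_gt0// mulr_gt0.
move=> n s r M m hs hsq mE r0 r1 hr mu4 bal.
have := @cond_prob_balanced R n s r M t m hs hsq mE r0 r1 hr mu4 bal K p eps L Rr
  K1 p0 p00 psum p11 eps01 L0 hR hL.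
by rewrite -/q -/delta [q * delta / 4 * _]mulrAC.
Qed.

(** As mu >= g ln n, the factor exp (- a mu) is at most n ^ (- 2 N1 - 2). This beats the at most n
    coarse cells and the (n + 1) ^ N1 <= n ^ (2 N1) profiles, leaving order 1 / n. *)
Lemma prob_giant_rate (R : realType) (K : nat) (p : nat -> R) (eps : R) :
  (1 < K)%N -> (forall k, 0 <= p k) -> p 0 = 0 -> \sum_(j < K.+1) p j = 1 ->
  p 1 < 1 -> 0 < eps < 1 ->
  exists gamma c : R, exists N : nat, 0 < gamma /\
    forall (n : nat) (r : R), (N <= n)%N -> 0 < r ->
      gamma * Num.sqrt (ln n%:R / n%:R) <= r ->
      1 - c / n%:R <= prob_giant K p n r eps <= 1.
Proof.
move=> K1 p0 p00 psum p11 eps01.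
have [a [Rr [t [N1 [N2 [a0 est]]]]]] := cond_prob_estimate K1 p0 p00 psum p11 eps01.
(* The second entry serves the profiles; the third makes the Chernoff exponent mu / (20 (t + 1) ^ 2)
   at least 2 ln n. *)
pose g : R := Num.max 1 (Num.max ((2 * N1 + 2)%N%:R / a) (40 * (t.+1 ^ 2)%:R)).
have g1 : 1 <= g by rewrite le_max lexx.
have g2 : (2 * N1 + 2)%N%:R / a <= g by rewrite !le_max lexx orbT.
have g3 : 40 * (t.+1 ^ 2)%:R <= g by rewrite !le_max lexx !orbT.
have g0 : 0 < g by apply: lt_le_trans g1.
(* M + 1 <= 4 / r' loses a factor 16 in mu, which the square of 4 g repays. The threshold gives ln n
   >= 32 g, hence n >= 16 g ln n, as needed when the radius is capped at 1. *)
exists (4 * g), (Rr%:R * (2 ^ N2)%:R + 2 * (t.+1 ^ 2)%:R), (Num.trunc (expR (32 * g))).+1.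
split; first by rewrite mulr_gt0.
move=> n r Nn r0 hr; clearbody g.
have nexp : expR (32 * g) <= n%:R.
  by apply: ltW; apply: lt_le_trans (truncnS_gt _) _; rewrite ler_nat.
have n0 : 0 < n%:R :> R by apply: lt_le_trans nexp; exact: expR_gt0.
pose l : R := ln n%:R; have lE : expR l = n%:R by rewrite lnK// posrE.
have l32 : 32 * g <= l by rewrite -ler_expR lE.
have l0 : 0 < l by lra.
have n2 : (2 <= n)%N.
  rewrite -(ler_nat R) -lE; apply: le_trans (expR_ge1Dx l); lra.
have nl : 16 * g * l <= n%:R.
  have := @expR_ge1Dxn R l 1 (ltW l0); rewrite lE (_ : 2`! = 2)%N// => h.
  have : 32 * g * l <= l ^+ 2 by rewrite expr2 ler_pM2r.
  lra.
pose r' := Num.min r 1.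
have r'0 : 0 < r' by rewrite lt_min r0 ltr01.
have r'1 : r' <= 1 by rewrite ge_min lexx orbT.
have nr : 16 * g * l <= n%:R * r' ^+ 2.
  rewrite /r' /Num.min; case: ltP => [r1|_]; last by rewrite expr1n mulr1.
  have lp : 0 <= l / n%:R by rewrite divr_ge0 ?ltW.
  have : (4 * g * Num.sqrt (l / n%:R)) ^+ 2 <= r ^+ 2.
    by apply: lerXn2r hr; rewrite nnegrE ?mulr_ge0 ?sqrtr_ge0// ltW.
  rewrite exprMn sqr_sqrtr// => h.
  have : n%:R * ((4 * g) ^+ 2 * (l / n%:R)) <= n%:R * r ^+ 2 by rewrite ler_pM2l.
  have -> : n%:R * ((4 * g) ^+ 2 * (l / n%:R)) = 16 * g * l * g by field; rewrite gt_eqF.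
  apply: le_trans; rewrite ler_peMr// ?mulr_ge0// ltW//.
(* Then 3 < (M + 1) r' <= 3 + r' <= 4. *)
pose M := Num.trunc (3 / r').
have Mr : 3 <= M.+1%:R * r' <= 4.
  have h1 := truncnS_gt (3 / r'); have h2 : M%:R <= 3 / r'.
    by rewrite truncn_le divr_ge0// ltW.
  apply/andP; split; first by rewrite -ler_pdivrMr// ltW.
  have : M%:R * r' <= 3 by rewrite -ler_pdivlMr.
  by rewrite -[M.+1%:R]natr1 mulrDl mul1r; lra.
pose mu : R := n%:R / (M.+1 ^ 2)%:R.
have M20 : 0 < (M.+1 ^ 2)%:R :> R by rewrite ltr0n expn_gt0.
have mul : g * l <= mu.
  rewrite /mu ler_pdivlMr//.
  have h4 : (M.+1%:R * r') ^+ 2 <= 4 ^+ 2.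
    by case/andP: Mr => ? ?; apply: lerXn2r; rewrite ?nnegrE// mulr_ge0// ltW.
  have rr : 0 < r' ^+ 2 by rewrite exprn_gt0.
  rewrite -(ler_pM2r rr) natrX -mulrA -exprMn.
  have gl : 0 <= g * l by rewrite mulr_ge0 ?ltW.
  have : g * l * (M.+1%:R * r') ^+ 2 <= g * l * 4 ^+ 2 by rewrite ler_wpM2l.
  lra.
have mul' : l <= mu by apply: le_trans mul; rewrite ler_peMl// ltW.
have mu4 : 4 <= mu by lra.
have M2n : (M.+1 ^ 2)%:R <= n%:R :> R.
  by rewrite -[leLHS]mul1r -ler_pdivlMr// -/mu; lra.
have t20 : 0 < (t.+1 ^ 2)%:R :> R by rewrite ltr0n expn_gt0.
pose m := (M.+1 * t.+1).-1; have mE : m.+1 = (M.+1 * t.+1)%N by rewrite prednK.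
have Xk (k : nat) (y : R) : k%:R * l <= y -> expR (- y) <= (n%:R ^+ k)^-1.
  by move=> h; rewrite -lE -expRM_natl -expRN ler_expR lerN2.
pose b : R := (M.+1 ^ 2)%:R * Rr%:R * ((n.+1 ^ N1 * 2 ^ N2)%:R * expR (- (a * mu))).
have b0 : 0 <= b by rewrite !mulr_ge0// expR_ge0.
have bX : b <= Rr%:R * (2 ^ N2)%:R / n%:R.
  have eX : expR (- (a * mu)) <= (n%:R ^+ (2 * N1 + 2))^-1.
    apply: Xk; move: g2; rewrite ler_pdivrMr// => g2.
    apply: (@le_trans _ _ (g * a * l)); first by rewrite ler_pM2r.
    by rewrite mulrAC mulrC ler_pM2l.
  have nX : (n.+1 ^ N1 * 2 ^ N2)%:R <= n%:R ^+ (2 * N1) * (2 ^ N2)%:R :> R.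
    rewrite -natrX -natrM ler_nat leq_mul2r; apply/orP; right.
    rewrite expnM; have : (n.+1 <= n ^ 2)%N.
      rewrite -mulnn; apply: (@leq_trans (n * 2)); last by rewrite leq_mul2l n2 orbT.
      by rewrite muln2 -addnn -addn1 leq_add2l ltnW.
    by case: (N1) => // k h; rewrite leq_exp2r.
  apply: (@le_trans _ _ (n%:R * Rr%:R * (n%:R ^+ (2 * N1) * (2 ^ N2)%:R * (n%:R ^+ (2 * N1 + 2))^-1))).
    apply: ler_pM; rewrite ?mulr_ge0 ?expR_ge0//; first by rewrite ler_wpM2r.
    by apply: ler_pM; rewrite ?expR_ge0.
  rewrite exprD le_eqVlt; apply/orP; left; apply/eqP; field.
  by rewrite expf_neq0 ?gt_eqF.
have e2X : 2 * (m.+1 ^ 2)%:R * expR (- (n%:R / (m.+1 ^ 2)%:R / 20)) <= 2 * (t.+1 ^ 2)%:R / n%:R :> R.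
  have mm : (m.+1 ^ 2 = M.+1 ^ 2 * t.+1 ^ 2)%N by rewrite mE expnMn.
  rewrite mm natrM.
  have eX : expR (- (n%:R / ((M.+1 ^ 2)%:R * (t.+1 ^ 2)%:R) / 20)) <= (n%:R ^+ 2)^-1 :> R.
    apply: Xk; rewrite invfM mulrA -/mu ler_pdivlMr// ler_pdivlMr//.
    have : 40 * (t.+1 ^ 2)%:R * l <= g * l by rewrite ler_pM2r.
    lra.
  apply: (@le_trans _ _ (2 * (n%:R * (t.+1 ^ 2)%:R) * (n%:R ^+ 2)^-1)).
    apply: ler_pM; rewrite ?expR_ge0 ?mulr_ge0//.
    by rewrite ler_pM2l// ler_pM2r.
  by rewrite le_eqVlt; apply/orP; left; apply/eqP; field; rewrite gt_eqF.
have [|lo ->] := andP (@prob_giant_ge R K p n m r eps b p0 psum b0 _).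
  move=> s hs hsq bal.
  rewrite (@cond_prob_eq_nbhd R n _ r r'); first exact: est hs hsq mE r'0 r'1 Mr mu4 bal.
  move=> u; apply: nbhd_min1 => v; apply: (allP hsq); rewrite mem_nth// hs//.
rewrite andbT; apply: le_trans lo; rewrite mulrDl; lra.
Qed.

(** If [p 1] were at least 1, no mass would be left for larger values and the mean would be at most
    1. *)
Lemma p1_lt1 (R : realType) (K : nat) (p : nat -> R) : (forall k, 0 <= p k) ->
  \sum_(j < K.+1) p j = 1 -> 1 < \sum_(k < K.+1) k%:R * p k -> p 1 < 1.
Proof.
move=> p0 psum mean; rewrite ltNge; apply/negP => p11; move: mean; rewrite ltNge; move/negP; apply.
rewrite -[leRHS]psum; apply: ler_sum => k _.
have [k1|k1] := leqP k 1; first by rewrite ler_piMl// lern1.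
have [K1|K1] := leqP K.+1 1; first by have := leq_trans (ltn_ord k) K1; rewrite ltnS leqNgt (ltnW k1).
suff -> : p k = 0 by rewrite mulr0.
apply/eqP; rewrite eq_le p0 andbT.
have : p 1 + p k <= 1.
  rewrite -psum (bigD1 (Ordinal K1))//= lerD2l (bigD1 k)/=.
    by rewrite lerDl sumr_ge0.
  by apply/eqP => h; move: k1; rewrite h.
lra.
Qed.

Local Open Scope classical_set_scope.

Theorem theorem1 (R : realType) (kappa : nat) (p : nat -> R) :
  (1 < kappa)%N ->
  (forall k, 0 <= p k) ->
  (forall k, (k < 1)%N \/ (kappa < k)%N -> p k = 0) ->
  \sum_(k < kappa.+1) p k = 1 ->
  1 < \sum_(k < kappa.+1) k%:R * p k ->
  forall eps : R, 0 < eps < 1 ->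
  exists gamma : R, 0 < gamma /\
    forall r : nat -> R,
      (forall n, 0 < r n) ->
      (forall n, gamma * Num.sqrt (ln n%:R / n%:R) <= r n) ->
      (fun n : nat => prob_giant kappa p n (r n) eps) @ \oo --> (1 : R).
Proof.
move=> K1 p0 psupp psum mean eps eps01.
have p00 : p 0 = 0 by apply: psupp; left.
have [gamma [c [N [gamma0 rate]]]] :=
  prob_giant_rate K1 p0 p00 psum (p1_lt1 p0 psum mean) eps01.
exists gamma; split=> // r r0 hr.
apply: (@squeeze_cvgr _ _ _ _ (fun n : nat => 1 - c / n%:R) (cst 1)).
- near=> n; apply: rate => //; near: n; exact: nbhs_infty_ge.
- rewrite -[X in _ --> X](subr0 (1 : R)); apply: cvgB; first exact: cvg_cst.
  rewrite -[X in _ --> X](mulr0 c); apply: cvgM; first exact: cvg_cst.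
  apply/gtr0_cvgV0.
    near=> n; rewrite ltr0n; near: n; exact: nbhs_infty_gt.
  exact: cvgr_idn.
- exact: cvg_cst.
Unshelve. all: by end_near. Qed.
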